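(* Let $\mu_0,\mu_1,\mu_2\in\mathbb{R}$ with $\mu_\star^2:=\mu_2-\mu_0^2-\mu_1^2\ge 0$, $\mu_\star:=\sqrt{\mu_\star^2}\ge 0$, and let $Z\sim\mathcal N(0,1)$. Consider the problem $$\min_\sigma\ \|\sigma\|_2:=\sqrt{\mathbb E\big((\sigma'(Z))^2\big)}\quad\text{subject to}\quad \mathbb E(\sigma(Z))=\mu_0,\ \ \mathbb E(Z\sigma(Z))=\mu_1,\ \ \mathbb E(\sigma(Z)^2)=\mu_2,$$ over all twice weakly differentiable functions $\sigma:\mathbb R\to\mathbb R$ such that $\mathbb E(\sigma(Z)^2)$ and $\mathbb E((\sigma'(Z))^2)$ are defined and finite. Then the minimizers of this problem are (up to equality almost everywhere) exactly the functions $$\sigma(x)=ax^2+bx+c,\qquad a=\pm\frac{\mu_\star}{\sqrt2},\quad b=\mu_1,\quad c=\mu_0-a .$$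
   Context: Derivatives are understood in the weak sense. Functions $\sigma$ that agree outside a set of measure zero (with respect to the Gaussian measure) are identified. The two choices of sign of $a$ give two minimizers when $\mu_\star>0$ and a single (affine) minimizer when $\mu_\star=0$. *)

(* Defs.v *)
From mathcomp Require Import all_boot all_order all_algebra.
From mathcomp Require Import all_classical all_reals all_analysis.

Set Implicit Arguments.
Unset Strict Implicit.
Unset Printing Implicit Defensive.

Import Order.TTheory GRing.Theory Num.Theory.
Import numFieldNormedType.Exports.

Local Open Scope classical_set_scope.
Local Open Scope ring_scope.

(* phi is in C_c^oo(R): smooth with compact support. *)
Definition test_function (R : realType) (phi : R -> R) : Prop :=
  (forall (n : nat) (x : R), derivable (phi^`(n)%classic : R -> R) x 1) /\
  compact (closure [set x | phi x != 0]).

(* [locally_integrable] includes Borel measurability. *)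
Definition is_weak_derive (R : realType) (f g : R -> R) : Prop :=
  [/\ locally_integrable setT f, locally_integrable setT g &
   forall phi : R -> R, test_function phi ->
     \int[lebesgue_measure]_x (f x * phi^`()%classic x) =
     - \int[lebesgue_measure]_x (g x * phi x)].

Definition weakly_derivable (R : realType) (f : R -> R) : Prop :=
  exists g, is_weak_derive f g.

(* A chosen representative of the weak derivative, which is unique up to
   equality almost everywhere. The default value 0, taken when f is not weakly
   differentiable, plays no role below: admissibility is always required. *)
Definition weak_derive (R : realType) (f : R -> R) : R -> R :=
  xget (fun=> 0) [set g | is_weak_derive f g].

Definition twice_weakly_derivable (R : realType) (f : R -> R) : Prop :=
  weakly_derivable f /\ weakly_derivable (weak_derive f).

(* On nonmeasurable sets the set functions underlying measures carry no
   information, whence the restriction to measurable A. *)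
Definition standard_normal d (T : measurableType d) (R : realType)
    (P : probability T R) (Z : {RV P >-> R}) : Prop :=
  forall A : set R, measurable A -> distribution P Z A = normal_prob 0 1 A.

Definition admissible d (T : measurableType d) (R : realType)
    (P : probability T R) (Z : {RV P >-> R}) (sigma : R -> R) : Prop :=
  [/\ twice_weakly_derivable sigma,
      P.-integrable setT (fun t => (sigma (Z t) ^+ 2)%:E) &
      P.-integrable setT (fun t => (weak_derive sigma (Z t) ^+ 2)%:E)].

Definition feasible d (T : measurableType d) (R : realType)
    (P : probability T R) (Z : {RV P >-> R}) (mu0 mu1 mu2 : R)
    (sigma : R -> R) : Prop :=
  [/\ admissible Z sigma,
      ('E_P[fun t => sigma (Z t)])%E = mu0%:E,
      ('E_P[fun t => (Z t * sigma (Z t))%R])%E = mu1%:E &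
      ('E_P[fun t => (sigma (Z t) ^+ 2)%R])%E = mu2%:E].

Definition sobolev_seminorm d (T : measurableType d) (R : realType)
    (P : probability T R) (Z : {RV P >-> R}) (sigma : R -> R) : R :=
  Num.sqrt (fine ('E_P[fun t => (weak_derive sigma (Z t) ^+ 2)%R])%E).

Definition is_minimizer d (T : measurableType d) (R : realType)
    (P : probability T R) (Z : {RV P >-> R}) (mu0 mu1 mu2 : R)
    (sigma : R -> R) : Prop :=
  feasible Z mu0 mu1 mu2 sigma /\
  forall tau : R -> R, feasible Z mu0 mu1 mu2 tau ->
    sobolev_seminorm Z sigma <= sobolev_seminorm Z tau.

(* Main.v *)
(* Let s x + c be the affine function that agrees at -1 and 1 with the absolutely continuous
   representative of sigma, and h = sigma - (s x + c). The second Hermite polynomial x^2 - 1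
   is the positive or negative ground state of the problem on each interval cut out by its
   zeros: Cauchy-Schwarz with the weight 2|t| = |(t^2 - 1)'| between x and the sign of x
   gives
     h(x)^2 <= |x^2 - 1| I(x),  where I(x) is the integral of h'(t)^2 / (2|t|) between them,
   and Tonelli's theorem gives E(|Z^2 - 1| I(Z)) = E(h'(Z)^2) / 2, so 2 E(h^2) <= E(h'^2).
   Expanding both sides, and using Stein's identity E(sigma'(Z)) = mu1, one finds
     E(sigma'^2) >= mu1^2 + 2 mustar^2 + 2 (c - mu0)^2 + (s - mu1)^2.
   Equality forces c = mu0, s = mu1 and equality in Cauchy-Schwarz, that is, h is
   proportional to x^2 - 1 on each of the four intervals with end points -1, 0, 1; the
   factors agree since h and, sigma being twice weakly differentiable, h' are continuous. *)

Require Import Defs.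
From mathcomp Require Import all_boot all_order all_algebra.
From mathcomp Require Import all_classical all_reals all_analysis.
From mathcomp Require Import measurable_realfun ring lra.
Set Implicit Arguments.
Unset Strict Implicit.
Unset Printing Implicit Defensive.
Import Order.TTheory GRing.Theory Num.Theory.
Import numFieldNormedType.Exports.
Local Open Scope classical_set_scope.
Local Open Scope ring_scope.

(** * Smooth test functions *)

Section smooth_functions.
Context {R : realType}.
Implicit Types (f g : R -> R) (n k : nat).

(** The bound is usually read off the Hermite expansion, where E(sigma^2) and E(sigma'^2) are the
    sums of a_k^2 and k a_k^2. Here orthogonality to the first two Hermite polynomials is replaced
    by vanishing at the two zeros of the second one, so neither completeness of a basis nor termwise
    differentiation enters. The price is that the affine part is fixed by two values of sigma and
    not by projection; the squares of c - mu0 and s - mu1 measure the discrepancy. Vanishing at -1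
    and 1 does not single out x^2 - 1 in the sharp inequality: |x^2 - 1| gives equality too. Such
    kinks are excluded by the continuity of the derivative, which the second weak derivative
    supplies. Weak derivatives are accessible only through test functions, so explicit ones are
    built: smoothed indicators of intervals, which recover f(b) - f(a) at Lebesgue points, and
    plateaus times the Gaussian density, which give Stein's identity. Both come from one smooth step
    made of exp(-1/x). *)

(** Continuity of the last derivative is not imposed; once all [n] are taken together in [smooth],
    it is automatic. *)
Fixpoint Ck n f : Prop :=
  if n is n'.+1 then (forall x, derivable f x 1) /\ Ck n' f^`()%classic else True.

Definition smooth f := forall n, Ck n f.

Lemma is_derive_derive1 f df :
  (forall x : R, is_derive x 1 f (df x)) -> f^`()%classic = df.
Proof.
by move=> fdf; apply/funext => x; rewrite derive1E; exact: (@derive_val _ _ _ _ _ _ _ (fdf x)).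
Qed.

Lemma CkS n f df :
  (forall x : R, is_derive x 1 f (df x)) -> Ck n df -> Ck n.+1 f.
Proof.
move=> fdf cdf; split; last by rewrite (is_derive_derive1 fdf).
by move=> x; have := fdf x => -[].
Qed.

Lemma CkSP n f : Ck n.+1 f ->
  (forall x : R, is_derive x 1 f (f^`()%classic x)) /\ Ck n f^`()%classic.
Proof. by move=> [df cf]; split=> // x; rewrite derive1E; exact: derivableP. Qed.

Lemma Ck_le n f : Ck n.+1 f -> Ck n f.
Proof. by elim: n f => // n IH f [df /IH]. Qed.

Lemma Ck_cst n (c : R) : Ck n (fun=> c).
Proof.
elim: n c => // n IH c; exact: (@CkS _ _ (fun=> 0)).
Qed.

Lemma CkD n f g : Ck n f -> Ck n g -> Ck n (fun x => f x + g x).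
Proof.
elim: n f g => // n IH f g /CkSP[df cf] /CkSP[dg cg].
apply: (@CkS _ _ (fun x => f^`()%classic x + g^`()%classic x)).
exact: IH.
Qed.

Lemma CkM n f g : Ck n f -> Ck n g -> Ck n (fun x => f x * g x).
Proof.
elim: n f g => // n IH f g cf cg.
have [df cdf] := CkSP cf; have [dg cdg] := CkSP cg.
apply: (@CkS _ _ (fun x => f x * g^`()%classic x + g x * f^`()%classic x)).
by apply: CkD; apply: IH => //; exact: Ck_le.
Qed.

(** The derivative -(1/f)(1/f) f' contains 1/f again, but only to one order less, so induction on
    [n] closes with [f] fixed. *)
Lemma CkV n f : (forall x, f x != 0) -> Ck n f -> Ck n (fun x => (f x)^-1).
Proof.
move=> f0; elim: n => // n IH cf.
have [df cdf] := CkSP cf.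
apply: (@CkS _ _ (fun x => (- 1) * ((f x)^-1 * (f x)^-1) * f^`()%classic x)).
  move=> x; apply: (is_derive_eq (is_deriveV (f0 x) (df x))).
  by rewrite expr2 invfM /GRing.scale/= mulN1r.
apply: CkM => //; apply: CkM; first exact: Ck_cst.
by apply: CkM; apply: IH; exact: Ck_le.
Qed.

Lemma Ck_id n : Ck n (@id R).
Proof.
case: n => // n; apply: (@CkS _ _ (fun=> 1)); exact: Ck_cst.
Qed.

Lemma is_derive_affine (c d x : R) : is_derive x 1 (fun x => c * x + d) c.
Proof.
apply: (is_derive_eq (is_deriveD
  (is_deriveM (is_derive_cst c x 1) (is_derive_id x 1)) (is_derive_cst d x 1))).
by rewrite addr0 scaler0 addr0 /GRing.scale/= mulr1.
Qed.

Lemma Ck_affine n (c d : R) f : Ck n f -> Ck n (fun x => f (c * x + d)).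
Proof.
elim: n f => // n IH f /CkSP[df cf].
apply: (@CkS _ _ (fun x => f^`()%classic (c * x + d) * c)).
  move=> x; apply: (@is_derive1_comp _ f (fun x => c * x + d)).
  exact: is_derive_affine.
by apply: CkM; [exact: IH|exact: Ck_cst].
Qed.

Lemma smooth_derivable n f : smooth f -> forall x, derivable (f^`(n)%classic : R -> R) x 1.
Proof.
move=> sf; suff : forall n m f, Ck (n + m) f -> Ck m f^`(n)%classic.
  by move=> H x; have /(H n 1%N f)[] := sf (n + 1)%N.
elim=> [|k IH] m h; first by rewrite add0n.
by rewrite addSnnS => /IH[].
Qed.

Lemma smooth_is_derive f (x : R) : smooth f -> is_derive x 1 f (f^`()%classic x).
Proof. by move=> /(_ 1%N)/CkSP[]. Qed.

Lemma smooth_derive1 f : smooth f -> smooth f^`()%classic.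
Proof. by move=> sf n; case: (sf n.+1). Qed.

Lemma is_derive_continuous f df :
  (forall x : R, is_derive x 1 f (df x)) -> continuous f.
Proof.
move=> fdf x; apply: differentiable_continuous; apply/derivable1_diffP.
by have := fdf x => -[].
Qed.

Lemma smooth_continuous f : smooth f -> continuous f.
Proof. by move=> sf; apply: is_derive_continuous => x; exact: smooth_is_derive. Qed.

Lemma smooth_test_function f M : smooth f ->
  (forall x, M < `|x| -> f x = 0) -> test_function f.
Proof.
move=> sf f0; split; first by move=> n x; exact: smooth_derivable.
apply: (subclosed_compact _ (@segment_compact R (- M) M)); first exact: closed_closure.
rewrite [X in _ `<=` X](closure_id _).1; last exact: itv_closed.
apply: closure_subset => x /= fx; rewrite in_itv/= -ler_norml leNgt.
by apply: contra fx => /f0 ->.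
Qed.

(* The family [flat k] is closed under derivation up to linear combinations, which gives
   smoothness of the flat function exp(-1/x) without polynomials in 1/x. *)
Definition flat k (x : R) : R := if 0 < x then x ^- k * expR (- x^-1) else 0.

(** With y = 1/x, one term of the exponential series gives exp(y) >= y^(k+2) / (k+2)!. A quadratic
    bound is what makes [flat k] differentiable at 0 with derivative 0. *)
Lemma flat_le k x : `|flat k x| <= (k.+2)`!%:R * x ^+ 2.
Proof.
rewrite /flat; case: ifPn => x0; last by rewrite normr0 mulr_ge0// sqr_ge0.
have y0 : 0 < x^-1 by rewrite invr_gt0.
rewrite ger0_norm; last by rewrite mulr_ge0 ?expR_ge0// invr_ge0 exprn_ge0// ltW.
rewrite expRN ler_pdivrMr ?expR_gt0// -exprVn.
have := @expR_ge1Dxn _ _ k.+1 (ltW y0).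
move=> /(le_trans _)H.
have {}H : (x^-1) ^+ k.+2 / (k.+2)`!%:R <= expR x^-1.
  by apply: H; rewrite lerDr.
apply: (@le_trans _ _ ((k.+2)`!%:R * x ^+ 2 * ((x^-1) ^+ k.+2 / (k.+2)`!%:R))).
  have -> : x^-1 ^+ k.+2 = x^-1 * (x^-1 * x^-1 ^+ k) by rewrite !exprS.
  rewrite le_eqVlt; apply/orP; left; apply/eqP.
  have F0 : (k.+2)`!%:R != 0 :> R by rewrite pnatr_eq0 -lt0n fact_gt0.
  set F := (k.+2)`!%:R in F0 *; set z := x^-1 ^+ k.
  by field; rewrite F0 gt_eqF.
by rewrite ler_pM2l// mulr_gt0// ?exprn_gt0// ltr0n fact_gt0.
Qed.

Lemma is_derive_sqr_le f c : f 0 = 0 -> (forall x, `|f x| <= c * x ^+ 2) ->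
  is_derive (0 : R) 1 f 0.
Proof.
move=> f0 fc.
have H : h^-1 *: (f (h *: 1 + 0) - f 0) @[h --> (0:R)^'] --> (0 : R).
  have c0 : (fun h : R => `|c| * `|h|) h @[h --> (0:R)^'] --> (0 : R).
    have c1 : continuous (fun h : R => `|c| * `|h|).
      move=> x; apply: (@continuousM _ _ (fun=> `|c|) (@Num.norm R R)); first exact: cst_continuous.
      exact: norm_continuous.
    have /continuous_withinNx := c1 0.
    by rewrite /= normr0 mulr0.
  apply: norm_cvg0; apply: (squeeze_cvgr _ (cvg_cst (0 : R)) c0).
    near=> h; rewrite normr_ge0/= f0 subr0 addr0 /GRing.scale/= mulr1 normrM normfV.
    have h0 : 0 < `|h| by rewrite normr_gt0; near: h; exact: nbhs_dnbhs_neq.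
    rewrite mulrC ler_pdivrMr// -mulrA -expr2.
    apply: (le_trans (fc h)); apply: (le_trans (ler_norm _)).
    by rewrite normrM normrX.
have D : derivable f 0 1 by apply/cvg_ex; exists 0.
by split => //; exact: cvg_lim.
Unshelve. all: by end_near. Qed.

Lemma is_derive_flat k (x : R) :
  is_derive x 1 (flat k) (flat k.+2 x - k%:R * flat k.+1 x).
Proof.
have [x0|x0|->] := ltrgtP x 0.
- rewrite /flat ltNge (ltW x0)/= mulr0 subr0.
  apply: (@near_eq_is_derive _ _ _ (fun=> 0)).
  near=> y; rewrite ifN// -leNgt ltW//.
  by near: y; exact: lt_nbhsl.
- rewrite /flat x0.
  have xn0 : x != 0 by rewrite gt_eqF.
  have dV : is_derive x 1 (fun y : R => y^-1) (- x ^- 2).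
    apply: (is_derive_eq (is_deriveV xn0 (is_derive_id _ _))).
    by rewrite /GRing.scale/= mulr1.
  have dE : is_derive x 1 (fun y : R => expR (- y^-1)) (expR (- x^-1) * x ^- 2).
    apply: (@is_derive1_comp _ expR (fun y => - y^-1)).
    by apply: (is_derive_eq (is_deriveN dV)); rewrite opprK.
  have dM := is_deriveM (is_deriveX k dV) dE.
  apply: (near_eq_is_derive _ (is_derive_eq dM _)).
    near=> y; rewrite ifT; last by near: y; exact: lt_nbhsr.
    by rewrite !fctE exprVn.
  rewrite !fctE /GRing.scale/= -!exprVn.
  by case: k {dM} => [|k]; rewrite /= ?exprS; ring.
- have flat0 : flat k 0 = 0 by rewrite /flat ltxx.
  apply: (is_derive_eq (is_derive_sqr_le flat0 (flat_le k))).
  by rewrite /flat ltxx mulr0 subr0.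
Unshelve. all: by end_near. Qed.

Lemma smooth_flat k : smooth (flat k).
Proof.
move=> n; elim: n k => // n IH k; apply: CkS; first by move=> x; exact: is_derive_flat.
apply: CkD => //; rewrite [X in Ck n X](_ : _ = fun x => (- k%:R) * flat k.+1 x).
  by apply: CkM => //; exact: Ck_cst.
by apply/funext => x; rewrite mulNr.
Qed.

Lemma flat0_gt0 x : 0 < x -> 0 < flat 0 x.
Proof. by move=> x0; rewrite /flat x0 expr0 invr1 mul1r expR_gt0. Qed.

Lemma flat_eq0 k x : x <= 0 -> flat k x = 0.
Proof. by rewrite /flat ltNge => ->. Qed.

Lemma flat0_ge0 x : 0 <= flat 0 x.
Proof. by have [/flat_eq0->//|/flat0_gt0/ltW] := leP x 0. Qed.

(** The denominator is positive since x and 1 - x are never both nonpositive. The form [-1 * x + 1]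
    is the one that [Ck_affine] accepts. *)
Definition step (x : R) : R := flat 0 x / (flat 0 x + flat 0 (-1 * x + 1)).

Lemma step_den_gt0 x : 0 < flat 0 x + flat 0 (-1 * x + 1).
Proof.
have [x0|x0] := leP x 0.
  by rewrite ltr_wpDl// ?flat0_ge0// flat0_gt0//; lra.
by rewrite ltr_wpDr// ?flat0_ge0// flat0_gt0.
Qed.

Lemma smooth_step : smooth step.
Proof.
move=> n; apply: CkM; first exact: smooth_flat.
apply: CkV; first by move=> x; rewrite gt_eqF// step_den_gt0.
by apply: CkD; [|apply: Ck_affine]; exact: smooth_flat.
Qed.

Lemma step0 x : x <= 0 -> step x = 0.
Proof. by move=> x0; rewrite /step flat_eq0// mul0r. Qed.

Lemma step1 x : 1 <= x -> step x = 1.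
Proof.
move=> x1; rewrite /step (@flat_eq0 _ (-1 * x + 1)); last lra.
by rewrite addr0 divff// gt_eqF// flat0_gt0//; lra.
Qed.

Lemma step_ge0 x : 0 <= step x.
Proof. by rewrite divr_ge0 ?flat0_ge0// ltW// step_den_gt0. Qed.

Lemma step_le1 x : step x <= 1.
Proof. by rewrite ler_pdivrMr ?step_den_gt0// mul1r lerDl flat0_ge0. Qed.

Lemma is_derive_step (x : R) : is_derive x 1 step (step^`()%classic x).
Proof. exact/smooth_is_derive/smooth_step. Qed.

Lemma dstep_out x : (x < 0) || (1 < x) -> step^`()%classic x = 0.
Proof.
move=> H; have [c ec] : exists c : R, \forall y \near x, step y = c.
  case/orP: H => [x0|x1].
    exists 0; near=> y; apply: step0; apply: ltW; near: y; exact: lt_nbhsl.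
  exists 1; near=> y; apply: step1; apply: ltW; near: y; exact: lt_nbhsr.
rewrite derive1E (@near_eq_derive _ _ _ _ (fun=> c))//.
exact: derive_cst.
Unshelve. all: by end_near. Qed.

Lemma dstep_bounded : exists2 C, 0 < C & forall x, `|step^`()%classic x| <= C.
Proof.
have cd : continuous step^`()%classic.
  exact/smooth_continuous/smooth_derive1/smooth_step.
have cdn : {within `[0, 1], continuous (fun x : R => `|step^`()%classic x|)}.
  apply: continuous_subspaceT => x.
  by apply: (@continuous_comp _ _ _ step^`()%classic (@Num.norm R R)); [exact: cd|exact: norm_continuous].
have [c _ cmax] := EVT_max (@ler01 R) cdn.
(* Adding 1 makes the constant positive, so that later estimates can divide by it. *)
exists (`|step^`()%classic c| + 1); first by rewrite ltr_pwDr.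
move=> x; have [x01|] := boolP (x \in `[0, 1]).
  by rewrite (le_trans (cmax _ x01))// lerDl.
rewrite in_itv/= negb_and -!ltNge => /dstep_out ->.
by rewrite normr0 addr_ge0.
Qed.

End smooth_functions.

(** * Integration on the real line *)

Section integral_tools.
Context {R : realType}.
Local Notation mu := (@lebesgue_measure R).
Implicit Types f g u : R -> R.

Lemma Rintegral_dominated_cvg {d} {T : measurableType d} (m : {measure set T -> \bar R})
    (f_ : nat -> T -> R) (f G : T -> R) :
  (forall n, measurable_fun setT (f_ n)) ->
  (forall x, f_ n x @[n --> \oo] --> f x) ->
  m.-integrable setT (EFin \o G) ->
  (forall n x, `|f_ n x| <= G x) ->
  \int[m]_x f_ n x @[n --> \oo] --> \int[m]_x f x.
Proof.
move=> mf cf iG fG.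
have mlim : measurable_fun setT f by apply: (measurable_fun_cvg mf).
have [] := @dominated_convergence _ _ _ m setT measurableT
  (fun n => EFin \o f_ n) (EFin \o f) (EFin \o G).
- by move=> n; exact/measurable_EFinP.
- exact/measurable_EFinP.
- by apply: aeW => x _; apply: cvg_EFin; [exact: nearW|exact: cf].
- exact: iG.
- by apply: aeW => x n _; rewrite /= lee_fin.
move=> If _ H; rewrite /Rintegral; apply: fine_cvg; rewrite fineK//.
exact: integrable_fin_num.
Qed.

Lemma ae_imp {d} {T : measurableType d} (m : {measure set T -> \bar R})
    (P Q : T -> Prop) : (forall x, P x -> Q x) ->
  {ae m, forall x, P x} -> {ae m, forall x, Q x}.
Proof. by move=> PQ; apply: (@filterS _ _ (ae_filter_ringOfSetsType m)). Qed.

Lemma ae_imp2 {d} {T : measurableType d} (m : {measure set T -> \bar R})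
    (P Q S : T -> Prop) : (forall x, P x -> Q x -> S x) ->
  {ae m, forall x, P x} -> {ae m, forall x, Q x} -> {ae m, forall x, S x}.
Proof. by move=> PQ; apply: (@filterS2 _ _ (ae_filter_ringOfSetsType m)). Qed.

Lemma integrableDr {d} {T : measurableType d} (m : {measure set T -> \bar R})
    (D : set T) (f g : T -> R) : measurable D ->
  m.-integrable D (EFin \o f) -> m.-integrable D (EFin \o g) ->
  m.-integrable D (EFin \o (fun x => f x + g x)).
Proof. by move=> mD; exact: integrableD. Qed.

Lemma integrableMlr {d} {T : measurableType d} (m : {measure set T -> \bar R})
    (D : set T) c (f : T -> R) : measurable D ->
  m.-integrable D (EFin \o f) -> m.-integrable D (EFin \o (fun x => c * f x)).
Proof.
move=> mD mf; rewrite (_ : EFin \o _ = fun x => (c%:E * (EFin \o f) x)%E)//.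
exact: integrableZl.
Qed.

Lemma locally_integrable_itv f a b : locally_integrable setT f ->
  mu.-integrable `[a, b] (EFin \o f).
Proof.
move=> [mf _ lf]; apply/integrableP; split.
  by apply/measurable_EFinP; exact: measurable_funTS.
exact: (lf _ (@subsetT _ _) (@segment_compact R a b)).
Qed.

Lemma locally_integrable_mul f u p q C : locally_integrable setT f ->
  measurable_fun setT u -> (forall x, `|u x| <= C * \1_`[p, q] x) ->
  mu.-integrable setT (EFin \o (fun x => f x * u x)).
Proof.
move=> lf mum uC; have [mf _ _] := lf.
have If : mu.-integrable setT (EFin \o (fun x => C * (f \_ `[p, q]) x)).
  rewrite (_ : EFin \o _ = fun x => (C%:E * ((EFin \o (f \_ `[p, q])) x))%E)//.
  apply: integrableZl => //.
  rewrite (_ : EFin \o _ = (EFin \o f) \_ `[p, q]); last by rewrite restrict_EFin.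
  apply: (proj1 (@integrable_mkcond _ _ _ mu _ (EFin \o f) (measurable_itv _))).
  exact: locally_integrable_itv.
apply: le_integrable If => //.
  by apply/measurable_EFinP; exact: measurable_funM.
move=> x _ /=; rewrite lee_fin !normrM patchE.
have := uC x; rewrite indicE; case: ifPn => xpq.
  rewrite mulr1 mulrC => H; apply: ler_wpM2r => //.
  by rewrite (le_trans H)// ler_norm.
by rewrite mulr0 normr_le0 => /eqP ->; rewrite normr0 !mulr0.
Qed.

Lemma Rintegral_itvD f a b c : a <= b -> b <= c ->
  mu.-integrable `[a, c] (EFin \o f) ->
  \int[mu]_(x in `[a, c]) f x =
  \int[mu]_(x in `[a, b]) f x + \int[mu]_(x in `[b, c]) f x.
Proof.
move=> ab bc lf.
have := @Rintegral_itvB R f (BLeft a) (BRight c) b.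
rewrite !bnd_simp ab bc => /(_ lf isT isT) H.
rewrite -[X in _ = _ + X]Rintegral_itv_obnd_cbnd.
  by rewrite -H addrC subrK.
apply: integrableS lf => // x /=; rewrite !in_itv/= => /andP[bx ->].
by rewrite andbT (le_trans ab)// ltW.
Qed.

Lemma locally_integrable_Rintegral_itvD f a b c : a <= b -> b <= c ->
  locally_integrable setT f ->
  \int[mu]_(x in `[a, c]) f x =
  \int[mu]_(x in `[a, b]) f x + \int[mu]_(x in `[b, c]) f x.
Proof. by move=> ab bc lf; apply: Rintegral_itvD => //; exact: locally_integrable_itv. Qed.

Lemma continuous_locally_integrable f : continuous f -> locally_integrable setT f.
Proof.
move=> cf; split; first exact: continuous_measurable_fun.
  exact: openT.
move=> K _ cK.
have : mu.-integrable K (EFin \o f).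
  by apply: continuous_compact_integrable => //; exact: continuous_subspaceT.
by move=> /integrableP[].
Qed.

Lemma FTC2_Rintegral (F f : R -> R) a b : a <= b ->
  (forall x : R, is_derive x 1 F (f x)) -> continuous f ->
  \int[mu]_(x in `[a, b]) f x = F b - F a.
Proof.
rewrite le_eqVlt => /predU1P[<- _ _|ab dF cf].
  by rewrite set_itv1 Rintegral_set1 subrr.
have cF : continuous F by exact: is_derive_continuous dF.
rewrite /Rintegral (continuous_FTC2 (F := F) ab) => [//|||].
- exact: continuous_subspaceT.
- split.
  + by move=> x _; have := dF x => -[].
  + by apply: cvg_at_right_filter; exact: cF.
  + by apply: cvg_at_left_filter; exact: cF.
- by move=> x _; rewrite (is_derive_derive1 dF).
Qed.

End integral_tools.

(** * Approximate identities at Lebesgue points *)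

Section mollification.
Context {R : realType}.
Local Notation mu := (@lebesgue_measure R).
Implicit Types f g u : R -> R.

(** A smooth Heaviside function: it rises from 0 at [a] to 1 at a + 1/(n+1). *)
Definition ramp (a : R) (n : nat) (x : R) : R := step (n.+1%:R * x + - (n.+1%:R * a)).

Lemma smooth_ramp a n : smooth (ramp a n).
Proof. by move=> k; apply: Ck_affine; exact: smooth_step. Qed.

Lemma is_derive_ramp a n (x : R) : is_derive x 1 (ramp a n)
  (step^`()%classic (n.+1%:R * x + - (n.+1%:R * a)) * n.+1%:R).
Proof.
apply: (@is_derive1_comp _ step (fun x => n.+1%:R * x + - (n.+1%:R * a))).
  exact: is_derive_step.
exact: is_derive_affine.
Qed.

Lemma derive_ramp a n : (ramp a n)^`()%classic =
  fun x => step^`()%classic (n.+1%:R * x + - (n.+1%:R * a)) * n.+1%:R.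
Proof. exact: (is_derive_derive1 (is_derive_ramp a n)). Qed.

Lemma ramp0 a n x : x <= a -> ramp a n x = 0.
Proof. by move=> xa; apply: step0; rewrite subr_le0 ler_pM2l. Qed.

Lemma ramp1 a n x : a + n.+1%:R^-1 <= x -> ramp a n x = 1.
Proof.
by move=> xa; apply: step1; rewrite -mulrBr mulrC -ler_pdivrMr// div1r lerBrDl.
Qed.

Lemma ramp_ge0 a n x : 0 <= ramp a n x. Proof. exact: step_ge0. Qed.

Lemma ramp_le1 a n x : ramp a n x <= 1. Proof. exact: step_le1. Qed.

Lemma derive_ramp_le C a n x : (forall x, `|step^`()%classic x| <= C) ->
  `|(ramp a n)^`()%classic x| <= C * n.+1%:R * \1_`[a, a + n.+1%:R^-1] x.
Proof.
move=> dC; rewrite derive_ramp normrM (ger0_norm (ler0n _ _)) indicE.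
have [xab|xab] := boolP (x \in `[a, a + n.+1%:R^-1]%classic).
  by rewrite mulr1 ler_wpM2r.
rewrite mulr0 dstep_out ?normr0 ?mul0r//.
move: xab; rewrite mem_setE in_itv/= negb_and -!ltNge => /orP[xa|xa]; apply/orP; [left|right].
  by rewrite subr_lt0 ltr_pM2l.
by rewrite -mulrBr mulrC -ltr_pdivrMr// div1r ltrBrDl.
Qed.

Lemma continuous_derive_ramp a n : continuous (ramp a n)^`()%classic.
Proof. exact/smooth_continuous/smooth_derive1/smooth_ramp. Qed.

Lemma measurable_derive_ramp a n : measurable_fun setT (ramp a n)^`()%classic.
Proof. by apply: continuous_measurable_fun; exact: continuous_derive_ramp. Qed.

Lemma integrable_mul_derive_ramp f a n : locally_integrable setT f ->
  mu.-integrable setT (EFin \o (fun x => f x * (ramp a n)^`()%classic x)).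
Proof.
move=> lf; have [C C0 dC] := @dstep_bounded R.
apply: (locally_integrable_mul lf); first exact: measurable_derive_ramp.
by move=> x; exact: derive_ramp_le.
Qed.

Lemma Rintegral_derive_ramp a n : \int[mu]_x (ramp a n)^`()%classic x = 1.
Proof.
have [C C0 dC] := @dstep_bounded R.
have aa : a <= a + n.+1%:R^-1 by rewrite lerDl invr_ge0.
transitivity (\int[mu]_(x in `[a, a + n.+1%:R^-1]) (ramp a n)^`()%classic x).
  rewrite [RHS]Rintegral_mkcond; apply: eq_Rintegral => x _.
  rewrite patchE; case: ifPn => // xab.
  have := derive_ramp_le a n x dC.
  by rewrite indicE (negbTE xab) mulr0 normr_le0 => /eqP.
have dr (x : R) : is_derive x 1 (ramp a n) ((ramp a n)^`()%classic x).
  exact/smooth_is_derive/smooth_ramp.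
rewrite (FTC2_Rintegral aa dr); last exact: continuous_derive_ramp.
by rewrite ramp1// ramp0// subr0.
Qed.

(* The derivatives of [ramp a n] form an approximate identity at [a], supported in
   [a, a + 1/(n+1)]; hence they detect the value at a Lebesgue point. *)
Lemma mollify_bound f a n C : locally_integrable setT f ->
  0 < C -> (forall x, `|step^`()%classic x| <= C) ->
  (`|\int[mu]_x (f x * (ramp a n)^`()%classic x) - f a|%:E <=
     (4 * C)%:E * davg f a (2 / n.+1%:R))%E.
Proof.
move=> lf C0 dC.
have [mf _ _] := lf.
have n0 : 0 < n.+1%:R :> R by [].
have lc : locally_integrable setT (fun x => f x - f a).
  apply: locally_integrableB => //; apply: continuous_locally_integrable.
  by move=> x; exact: cst_continuous.
have I1 := integrable_mul_derive_ramp a n lf.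
have I2 : mu.-integrable setT (EFin \o (fun x => f a * (ramp a n)^`()%classic x)).
  apply: integrable_mul_derive_ramp; apply: continuous_locally_integrable.
  by move=> x; exact: cst_continuous.
have I0 : mu.-integrable setT (EFin \o (fun x => (ramp a n)^`()%classic x)).
  have : mu.-integrable setT (EFin \o (fun x => 1 * (ramp a n)^`()%classic x)).
    apply: (@integrable_mul_derive_ramp (fun=> 1)).
    apply: continuous_locally_integrable.
    by move=> x; exact: cst_continuous.
  by apply: eq_integrable => // x _; rewrite /= mul1r.
(* The derivative of the ramp has integral 1, so the constant [f a] can be moved under the
   integral. *)
have -> : \int[mu]_x (f x * (ramp a n)^`()%classic x) - f a =
    \int[mu]_x ((f x - f a) * (ramp a n)^`()%classic x).
  under [RHS]eq_Rintegral do rewrite mulrBl.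
  rewrite RintegralB//; congr (_ - _).
  by rewrite RintegralZl// Rintegral_derive_ramp mulr1.
rewrite EFin_normr_Rintegral//; last exact: integrable_mul_derive_ramp.
apply: (le_trans (le_abse_integral _ _ _)) => //.
  apply/measurable_EFinP; apply: measurable_funM; last exact: measurable_derive_ramp.
  exact: measurable_funB.
(* The open ball of radius 2/(n+1) contains the closed support [a, a + 1/(n+1)]. Its length 4/(n+1)
   times the bound C (n+1) on the derivative is the constant 4 C. *)
rewrite /davg /iavg lebesgue_measure_ball ?divr_ge0//.
set D := ball a _.
have mD : measurable D by exact: measurable_ball.
apply: (@le_trans _ _ (\int[mu]_(x in D) ((C * n.+1%:R)%:E * `|(f x - f a)%:E|))%E).
  rewrite [leRHS]integral_mkcond; apply: ge0_le_integral => //.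
  - apply/measurableT_comp => //; apply/measurable_EFinP; apply: measurable_funM.
      exact: measurable_funB.
    exact: measurable_derive_ramp.
  - apply/(measurable_restrictT _ _).1 => //; apply: measurable_funTS.
    apply: emeasurable_funM => //.
    by apply/measurableT_comp => //; apply/measurable_EFinP; exact: measurable_funB.
  - move=> x xT; rewrite patchE /=.
    have H := derive_ramp_le a n x dC.
    rewrite -EFinM normrM mulrC.
    case: ifPn => xD.
      rewrite lee_fin ler_wpM2r// (le_trans H)// ler_piMr//.
        by rewrite mulr_ge0// ltW.
    have -> : (point : \bar R) = 0%E by [].
    rewrite lee_fin; move: H; rewrite indicE memNset ?mulr0.
      by rewrite normr_le0 => /eqP ->; rewrite normr0 mul0r.
    move: xD; rewrite notin_setE => xD /=; rewrite in_itv/= => /andP[ax xa].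
    apply: xD; rewrite /D /ball/= distrC ger0_norm ?subr_ge0//.
    rewrite ltrBlDl (le_lt_trans xa)// ltrD2l ltr_pMl ?invr_gt0//.
    by rewrite ltr1n.
rewrite ge0_integralZl//; last 2 first.
- apply/measurableT_comp => //; apply/measurable_EFinP; apply: measurable_funTS.
  exact: measurable_funB.
- by rewrite lee_fin mulr_ge0// ltW.
rewrite inver ifF; last by apply/negbTE; rewrite mulrn_eq0/= mulf_neq0// invr_neq0.
rewrite muleA -EFinM; apply: lee_pmul => //.
  by rewrite lee_fin mulr_ge0// ltW.
  by apply: integral_ge0.
rewrite lee_fin -mulr_natr le_eqVlt; apply/orP; left; apply/eqP.
by field; rewrite ?pnatr_eq0// gt_eqF.
Qed.

Lemma mollify_cvg f a : locally_integrable setT f -> lebesgue_pt f a ->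
  \int[mu]_x (f x * (ramp a n)^`()%classic x) @[n --> \oo] --> f a.
Proof.
move=> lf fa; have [C C0 dC] := @dstep_bounded R.
have r0 : (2 / n.+1%:R : R) @[n --> \oo] --> (0 : R).
  rewrite -[X in _ --> X](mulr0 (2 : R)); apply: cvgMr.
  exact: cvg_harmonic.
have rp : (2 / n.+1%:R : R) @[n --> \oo] --> (0 : R)^'+.
  by move=> A [e /= e0 eA]; move/cvgrPdist_lt : r0 => /(_ _ e0); apply: filterS => n;
    move=> H; apply: eA => //=; rewrite divr_gt0.
have dc : (davg f a (2 / n.+1%:R)) @[n --> \oo] --> 0%E.
  exact: (cvg_comp _ _ rp fa).
apply/cvgrPdist_le => e e0.
have dlt : \forall n \near \oo, (davg f a (2 / n.+1%:R) < (e / (4 * C))%:E)%E.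
  have e4 : (0 < (e / (4 * C))%:E)%E by rewrite lte_fin divr_gt0// mulr_gt0.
  exact: (dc _ (open_ereal_lt' e4)).
near=> n.
rewrite distrC -lee_fin; apply: (le_trans (mollify_bound a n lf C0 dC)).
have d0 : (davg f a (2 / n.+1%:R) <= (e / (4 * C))%:E)%E by apply: ltW; near: n.
apply: (le_trans (lee_pmul _ _ (lexx _) d0)).
- by rewrite lee_fin mulr_ge0// ltW.
- exact: davg_ge0.
- by rewrite -EFinM lee_fin mulrC divfK// mulf_neq0// gt_eqF.
Unshelve. all: by end_near. Qed.

End mollification.

(** * Weak derivatives and absolutely continuous representatives *)

Section weak_derivatives.
Context {R : realType}.
Local Notation mu := (@lebesgue_measure R).
Implicit Types f g F : R -> R.

(** Every ramp vanishes at [a] itself, whence the half-line open at [a]. *)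
Lemma ramp_cvg (a x : R) : ramp a n x @[n --> \oo] --> (\1_`]a, +oo[ x : R).
Proof.
have [xa|ax] := leP x a.
  rewrite indicE memNset ?mulr0n/=; last by rewrite in_itv/= andbT => /(le_lt_trans xa); rewrite ltxx.
  by under eq_fun do rewrite ramp0//; exact: cvg_cst.
rewrite indicE mem_set/=; last by rewrite in_itv/= ax.
apply: cvg_near_cst; near=> n; apply: ramp1.
rewrite -lerBrDl -[leRHS]invrK lef_pV2 ?posrE ?invr_gt0 ?subr_gt0//.
rewrite (@le_trans _ _ n%:R)//; last by rewrite ler_nat.
by near: n; exact: nbhs_infty_ger.
Unshelve. all: by end_near. Qed.

(* Testing a weak derivative against [tent a b n] gives f(b) - f(a) = int_a^b g in the limit. *)
Definition tent (a b : R) n x := ramp a n x + (-1) * ramp b n x.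

Lemma tent_is_derive a b n (x : R) : is_derive x 1 (tent a b n)
  ((ramp a n)^`()%classic x - (ramp b n)^`()%classic x).
Proof.
have -> : tent a b n = ramp a n - ramp b n by apply/funext => y; rewrite /tent mulN1r.
by apply: is_deriveB; apply: smooth_is_derive; exact: smooth_ramp.
Qed.

(** The support ends at b + 1/(n+1); the bound b + 1 serves all [n] at once and so yields a single
    dominating function. *)
Lemma tent_out a b n x : a < b -> x \notin `[a, b + 1] -> tent a b n x = 0.
Proof.
move=> ab; rewrite in_itv/= negb_and -!ltNge /tent => /orP[xa|bx].
  by rewrite !ramp0 ?mulr0 ?addr0// ltW// (lt_trans xa).
have n1 : n.+1%:R^-1 <= 1 :> R by rewrite invf_le1// ler1n.
have bn : b + n.+1%:R^-1 <= x by rewrite (le_trans _ (ltW bx))// lerD2l.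
by rewrite !ramp1// ?mulr1 ?subrr// (le_trans _ bn)// lerD2r ltW.
Qed.

Lemma tent_test a b n : a < b -> test_function (tent a b n).
Proof.
move=> ab; apply: (@smooth_test_function _ _ (`|a| + `|b + 1|)).
  move=> k; apply: CkD; first exact: smooth_ramp.
  by apply: CkM; [exact: Ck_cst|exact: smooth_ramp].
move=> x xM; apply: tent_out => //; apply: contraL xM.
rewrite in_itv/= -leNgt => /andP[ax xb].
have := ler_norm (b + 1); have := ler_norm (- a); rewrite normrN.
have := normr_ge0 a; have := normr_ge0 (b + 1).
by rewrite ler_norml => *; apply/andP; split; lra.
Qed.

Lemma tent_le a b n x : a < b -> `|tent a b n x| <= \1_`[a, b + 1] x.
Proof.
move=> ab; have [xab|xab] := boolP (x \in `[a, b + 1]).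
  rewrite indicE mem_set// /tent mulN1r ler_norml.
  have := ramp_ge0 a n x; have := ramp_ge0 b n x.
  have := ramp_le1 a n x; have := ramp_le1 b n x.
  by rewrite mulr1n => *; apply/andP; split; lra.
by rewrite tent_out// normr0.
Qed.

(** Dominated convergence: the tents tend to the indicator of ]a, b], below the integrable function
    |g| on [a, b + 1]. *)
Lemma Rintegral_tent_cvg g a b : a < b -> locally_integrable setT g ->
  \int[mu]_x (g x * tent a b n x) @[n --> \oo] --> \int[mu]_(x in `[a, b]) g x.
Proof.
move=> ab lg; have [mg _ _] := lg.
have -> : \int[mu]_(x in `[a, b]) g x =
    \int[mu]_x (g x * (\1_`]a, +oo[ x + (-1) * \1_`]b, +oo[ x)).
  rewrite -Rintegral_itv_obnd_cbnd; last first.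
    apply: integrableS (locally_integrable_itv a b lg) => //.
    by move=> x /=; rewrite !in_itv/= => /andP[/ltW -> ->].
  rewrite Rintegral_mkcond; apply: eq_Rintegral => x _.
  rewrite patchE !indicE !mem_setE !in_itv/= !andbT.
  have [xb|bx] := leP x b; last by rewrite (lt_trans ab bx) andbF mulr1 subrr mulr0.
  by rewrite andbT mulr0 addr0; case: ifPn; rewrite ?mulr1 ?mulr0.
apply: (@Rintegral_dominated_cvg _ _ _ mu _ _ (fun x => `|g x * \1_`[a, b + 1] x|)).
- move=> n; apply: measurable_funM => //; apply: continuous_measurable_fun.
  exact: (is_derive_continuous (tent_is_derive a b n)).
- move=> x; apply: cvgMr; apply: cvgD; first exact: ramp_cvg.
  by apply: cvgMr; exact: ramp_cvg.
- rewrite (_ : EFin \o _ = abse \o (EFin \o (fun x => g x * \1_`[a, b + 1] x)))//.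
  apply: integrable_abse; apply: (@locally_integrable_mul _ _ _ a (b + 1) 1) => //.
  by move=> x; rewrite mul1r ger0_norm.
- move=> n x; rewrite !normrM ler_wpM2l// (le_trans (tent_le _ _ ab))//.
  exact: ler_norm.
Qed.

(** The derivative of the tent is an approximate Dirac mass at [a] minus one at [b], so both sides
    of the weak identity converge. *)
Lemma weak_derive_lebesgue_pt f g a b : is_weak_derive f g -> a < b ->
  lebesgue_pt f a -> lebesgue_pt f b -> f b - f a = \int[mu]_(x in `[a, b]) g x.
Proof.
move=> [lf lg fg] ab fa fb.
have cg := Rintegral_tent_cvg ab lg.
have cf : \int[mu]_x (f x * (tent a b n)^`()%classic x) @[n --> \oo] --> f a - f b.
  rewrite [X in X @ _](_ : _ = fun n => \int[mu]_x (f x * (ramp a n)^`()%classic x) -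
      \int[mu]_x (f x * (ramp b n)^`()%classic x)).
    by apply: cvgB; exact: mollify_cvg.
  apply/funext => n; rewrite -RintegralB//; [|exact: integrable_mul_derive_ramp..].
  by apply: eq_Rintegral => x _; rewrite (is_derive_derive1 (tent_is_derive a b n)) mulrBr.
have {}cf : (- \int[mu]_x (g x * tent a b n x)) @[n --> \oo] --> f a - f b.
  rewrite [X in X @ _](_ : _ = fun n => \int[mu]_x (f x * (tent a b n)^`()%classic x))//.
  by apply/funext => n; rewrite fg//; exact: tent_test.
have := cvg_unique _ cf (cvgN cg) => /(_ (@norm_hausdorff _ _)) H.
by rewrite -[RHS]opprK -H opprB.
Qed.

Lemma ae_exists_itv (P : set R) a b : a < b -> {ae mu, forall x, P x} ->
  exists2 x, x \in `]a, b[ & P x.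
Proof.
move=> ab [N [mN N0 PN]]; apply: contrapT => nP.
have : (mu `]a, b[ <= mu N)%E.
  rewrite le_measure ?inE//.
  by move=> x /= xab; apply: PN => Px; apply: nP; exists x.
rewrite N0 lebesgue_measure_itv/= lte_fin ab -EFinB lee_fin subr_le0.
by rewrite leNgt ab.
Qed.

(** This is local absolute continuity of [F] with density [g], in integral form: [g] may be changed
    on a null set, and no pointwise derivative is mentioned. *)
Definition antiderivative F g := locally_integrable setT g /\
  forall a b : R, a <= b -> F b - F a = \int[mu]_(x in `[a, b]) g x.

Lemma weak_derive_antiderivative f g : is_weak_derive f g ->
  exists2 F, antiderivative F g & {ae mu, forall x, f x = F x}.
Proof.
move=> fg; have [lf lg _] := fg.
have lp := lebesgue_differentiation lf.
(* Any Lebesgue point of [f] can serve as base point. Integrating [g] from there gives a function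
   that agrees with [f] at all other Lebesgue points, hence almost everywhere. *)
have [x0 _ fx0] := ae_exists_itv (@ltr01 R) lp.
pose F x := f x0 + (if x0 <= x then \int[mu]_(t in `[x0, x]) g t
                    else - \int[mu]_(t in `[x, x0]) g t).
exists F.
  split=> // a b ab; rewrite /F.
  have [xa|ax] := leP x0 a.
    by rewrite (le_trans xa ab) (locally_integrable_Rintegral_itvD xa ab lg); ring.
  have [xb|bx] := leP x0 b.
    by rewrite (locally_integrable_Rintegral_itvD (ltW ax) xb lg); ring.
  by rewrite (locally_integrable_Rintegral_itvD ab (ltW bx) lg); ring.
apply: ae_imp lp => x fx; rewrite /F.
have [x0x|xx0|<-] := ltgtP x0 x.
- by rewrite -(weak_derive_lebesgue_pt fg x0x fx0 fx); ring.
- by rewrite -(weak_derive_lebesgue_pt fg xx0 fx fx0); ring.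
- by rewrite set_itv1 Rintegral_set1 addr0.
Qed.

(** Near [x] the function [F] is F(x - 1) plus the integral of [g] from x - 1, to which the
    fundamental theorem at Lebesgue points applies. *)
Lemma antiderivative_lebesgue_pt F g x : antiderivative F g -> lebesgue_pt g x ->
  is_derive x 1 F (g x).
Proof.
move=> [lg Fg] gx.
have x1 : x < x + 1 by rewrite ltrDl.
have [] := @FTC1_lebesgue_pt _ g (BLeft (x - 1)) x (x + 1) x1.
- exact: locally_integrable_itv.
- by rewrite /= lte_fin gtrBl.
- exact: gx.
move=> dG Gx.
have dG' : is_derive x 1 (fun y => F (x - 1) + \int[mu]_(t in `[x - 1, y]) g t) (g x).
  apply: (is_derive_eq (is_deriveD (is_derive_cst (F (x - 1)) x 1) (derivableP dG))).
  by rewrite add0r -derive1E.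
apply: near_eq_is_derive dG'; near=> y.
have xy : x - 1 <= y by apply: ltW; near: y; apply: lt_nbhsr; rewrite gtrBl.
by rewrite -(Fg _ _ xy) addrCA subrr addr0.
Unshelve. all: by end_near. Qed.

Lemma antiderivative_continuous F g : antiderivative F g -> continuous F.
Proof.
move=> [lg Fg] x.
have xx : x - 1 < x + 1 by lra.
have := @parameterized_integral_continuous _ (x - 1) (x + 1) g (ltW xx)
  (locally_integrable_itv _ _ lg).
move=> /(continuous_within_itvP _ xx)[+ _ _].
move=> /(_ x); rewrite in_itv/= => H.
have {}H : {for x, continuous (fun y => parameterized_integral mu (x - 1) y g)}.
  by apply: H; apply/andP; split; lra.
have {}H : (F (x - 1) + parameterized_integral mu (x - 1) y g) @[y --> x] -->
   F (x - 1) + parameterized_integral mu (x - 1) x g.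
  by apply: cvgD; [exact: cvg_cst|exact: H].
rewrite /parameterized_integral -(Fg (x - 1) x) in H; last lra.
rewrite addrCA subrr addr0 in H.
apply: cvg_trans H; apply: near_eq_cvg; near=> y.
have xy : x - 1 <= y by apply: ltW; near: y; apply: lt_nbhsr; rewrite gtrBl.
by rewrite -(Fg _ _ xy) addrCA subrr addr0.
Unshelve. all: by end_near. Qed.

(** A nonzero difference at one point would persist on an interval, which is not a null set. *)
Lemma ae_eq_continuous F g : continuous F -> continuous g ->
  {ae mu, forall x, F x = g x} -> F = g.
Proof.
move=> cF cg Fg; apply/funext => x; apply/eqP; rewrite -subr_eq0; apply/negPn/negP => Fgx.
have cd : {for x, continuous (fun y => F y - g y)}.
  by apply: cvgB; [exact: cF|exact: cg].
have := cvgr_neq0 _ cd Fgx.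
move=> [e /= e0 xe].
have xxe : x < x + e by rewrite ltrDl.
have [y yxe /eqP] := ae_exists_itv xxe Fg.
rewrite -subr_eq0; apply/negP; apply: xe => /=.
move: yxe; rewrite in_itv/= => /andP[xy yxe].
by rewrite distrC gtr0_norm ?subr_gt0// ltrBlDl.
Qed.

(* Two weak derivatives of f have almost everywhere equal, hence equal, continuous
   antiderivatives. *)
Lemma weak_derive_ae_unique f g1 g2 : is_weak_derive f g1 -> is_weak_derive f g2 ->
  {ae mu, forall x, g1 x = g2 x}.
Proof.
move=> /[dup] fg1 /weak_derive_antiderivative[F1 F1g fF1].
move=> /[dup] fg2 /weak_derive_antiderivative[F2 F2g fF2].
have F12 : F1 = F2.
  apply: ae_eq_continuous; [exact: antiderivative_continuous F1g|
    exact: antiderivative_continuous F2g|].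
  by apply: ae_imp2 fF1 fF2 => x <-.
have [_ lg1 _] := fg1; have [_ lg2 _] := fg2.
apply: ae_imp2 (lebesgue_differentiation lg1) (lebesgue_differentiation lg2) => x x1 x2.
have d1 := antiderivative_lebesgue_pt F1g x1.
have d2 := antiderivative_lebesgue_pt F2g x2.
rewrite -(@derive_val _ _ _ _ _ _ _ d1) F12.
exact: (@derive_val _ _ _ _ _ _ _ d2).
Qed.

End weak_derivatives.

(** * The standard normal distribution *)

Section gaussian_density.
Context {R : realType}.
Local Notation mu := (@lebesgue_measure R).
Local Notation N := (@normal_prob R 0 1).
Local Notation phi := (@normal_pdf R 0 1).
Implicit Types u f g : R -> R.

Let s1 : (1 : R) != 0 := oner_neq0 R.

Lemma normal_pdf01E x : phi x = @normal_peak R 1 * expR (- (x ^+ 2 / 2)).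
Proof. by rewrite (normal_pdfE _ s1) /normal_fun subr0 expr1n mulNr. Qed.

Lemma normal_pdf01_gt0 x : 0 < phi x.
Proof. by rewrite normal_pdf01E mulr_gt0 ?expR_gt0// normal_peak_gt0. Qed.

Lemma is_derive_normal_pdf (x : R) : is_derive x 1 phi (- x * phi x).
Proof.
have d2 : is_derive x 1 (fun x : R => (- (2^-1)) * (x * x)) (- x).
  have H (c : R) : is_derive x 1 (fun x : R => c * (x * x)) (c * (x + x)).
    apply: (is_derive_eq (is_deriveM (is_derive_cst c x 1)
      (is_deriveM (is_derive_id x 1) (is_derive_id x 1)))).
    by rewrite scaler0 addr0 /GRing.scale/= mulr1.
  by apply: (is_derive_eq (H _)); field.
have dE := @is_derive1_comp _ expR _ x _ _ (is_derive_expR _) d2.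
have dP := is_deriveM (is_derive_cst (@normal_peak R 1) x 1) dE.
have -> : phi = cst (@normal_peak R 1) * (expR \o (fun x : R => (- (2^-1)) * (x * x))).
  by apply/funext => y; rewrite normal_pdf01E /=; congr (_ * expR _); field.
apply: (is_derive_eq dP).
by rewrite scaler0 addr0 !fctE /GRing.scale/=; ring.
Qed.

(** Since phi' = -x phi, differentiability of order [n] passes to order n + 1. *)
Lemma smooth_normal_pdf : smooth phi.
Proof.
elim=> // n IH; apply: CkS; first exact: is_derive_normal_pdf.
apply: CkM => //; rewrite (_ : -%R = fun x : R => (-1) * x + 0).
  by apply: (@Ck_affine _ n (-1) 0 id); exact: Ck_id.
by apply/funext => x; rewrite addr0 mulN1r.
Qed.

Lemma continuous_normal_pdf01 : continuous phi.
Proof. exact: continuous_normal_pdf. Qed.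

(** The change of variables is expressed by a Radon-Nikodym derivative, determined only almost
    everywhere; it is identified with [phi] because both have the same integral over every
    measurable set. *)
Lemma ge0_integral_normal_prob u : measurable_fun setT u -> (forall x, 0 <= u x) ->
  (\int[N]_x (u x)%:E = \int[mu]_x (u x * phi x)%:E)%E.
Proof.
move=> mum u0; have numu := @normal_prob_dominates R 0 1.
rewrite -(Radon_Nikodym_SigmaFinite.change_of_variables numu)//; last exact/measurable_EFinP.
have mphi := @measurable_normal_pdf R 0 1.
have iRN := Radon_Nikodym_SigmaFinite.f_integrable numu.
under [RHS]eq_integral do rewrite EFinM.
apply: ae_eq_integral => //.
- apply: emeasurable_funM; first exact/measurable_EFinP.
  exact: measurable_int iRN.
- by apply: emeasurable_funM; exact/measurable_EFinP.
- apply: ae_eqe_mul2l; apply: integral_ae_eq => //.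
  + exact/measurable_EFinP.
  + by move=> A _ mA; rewrite -(Radon_Nikodym_SigmaFinite.f_integral numu).
Qed.

Lemma integrable_normal_prob u : measurable_fun setT u ->
  N.-integrable setT (EFin \o u) <->
  mu.-integrable setT (EFin \o (fun x => u x * phi x)).
Proof.
move=> mum; have mphi := @measurable_normal_pdf R 0 1.
have H : (\int[N]_x `|(EFin \o u) x| = \int[mu]_x `|(EFin \o (fun x => (u x * phi x)%R)) x|)%E.
  rewrite /= (@ge0_integral_normal_prob (fun x => `|u x|)) => [|//|//].
    by apply: eq_integral => x _; rewrite normrM (ger0_norm (normal_pdf_ge0 _ _ _)).
  exact: measurableT_comp.
split=> /integrableP[_ iu]; apply/integrableP; split.
- by apply/measurable_EFinP; exact: measurable_funM.
- by rewrite -H.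
- exact/measurable_EFinP.
- by rewrite H.
Qed.

Lemma Rintegral_normal_prob u : N.-integrable setT (EFin \o u) ->
  \int[N]_x u x = \int[mu]_x (u x * phi x).
Proof.
move=> iu; have mum : measurable_fun setT u by apply/measurable_EFinP; exact: measurable_int iu.
have mphi := @measurable_normal_pdf R 0 1.
have numu := @normal_prob_dominates R 0 1.
rewrite /Rintegral -(Radon_Nikodym_change_of_variables numu)//; congr fine.
under [RHS]eq_integral do rewrite EFinM.
apply: ae_eq_integral => //.
- apply: emeasurable_funM; first exact/measurable_EFinP.
  by apply: (measurable_int mu); apply: Radon_Nikodym_integrable; exact: normal_prob_dominates.
- by apply: emeasurable_funM; exact/measurable_EFinP.
- apply: ae_eqe_mul2l; apply: integral_ae_eq => //.
  + by apply: Radon_Nikodym_integrable; exact: normal_prob_dominates.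
  + exact/measurable_EFinP.
  + by move=> A _ mA; rewrite -Radon_Nikodym_integral//; exact: normal_prob_dominates.
Qed.

(** One direction is absolute continuity. For the other, a Gaussian null set is Lebesgue null since
    [phi] is positive everywhere. *)
Lemma ae_normal_lebesgue (P : set R) : 
  {ae N, forall x, P x} <-> {ae mu, forall x, P x}.
Proof.
have mphi := @measurable_normal_pdf R 0 1.
split=> -[A [mA A0 PA]]; exists A; split => //; last first.
  by have /null_content_dominatesP := @normal_prob_dominates R 0 1; apply.
move: A0; rewrite /N /normal_prob.
move=> A0; have : (\int[mu]_(x in A) `|(phi x)%:E| = 0)%E.
  by rewrite -A0; apply: eq_integral => x _; rewrite gee0_abs// lee_fin normal_pdf_ge0.
move=> /ae_eq_integral_abs => /(_ mA)[].
  by apply/measurable_EFinP; exact: measurable_funTS.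
move=> B [mB B0 AB].
apply/eqP; rewrite eq_le measure_ge0 andbT -B0; apply: le_measure; rewrite ?inE//.
move=> x Ax; apply: AB => /= /(_ Ax) [] /eqP.
by rewrite gt_eqF// normal_pdf01_gt0.
Qed.

End gaussian_density.

(** * Classical derivatives as weak derivatives, and Stein's identity *)

Section stein.
Context {R : realType}.
Local Notation mu := (@lebesgue_measure R).
Local Notation N := (@normal_prob R 0 1).
Local Notation phi := (@normal_pdf R 0 1).
Implicit Types f g u F : R -> R.

Lemma Rintegral_support u a b : (forall x, x \notin `[a, b] -> u x = 0) ->
  \int[mu]_x u x = \int[mu]_(x in `[a, b]) u x.
Proof.
move=> u0; rewrite [RHS]Rintegral_mkcond; apply: eq_Rintegral => x _.
by rewrite patchE; case: ifPn => //; rewrite mem_setE => /u0.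
Qed.

Lemma test_function_support (psi : R -> R) : test_function psi ->
  exists M, forall x, M < `|x| -> psi x = 0.
Proof.
move=> [_ /compact_bounded[M [_ HM]]]; exists (M + 1) => x xM.
apply/eqP/negPn/negP => px.
have MM : M < M + 1 by rewrite ltrDl.
have cx : closure [set x | psi x != 0] x by apply: subset_closure.
by have /= := HM _ MM x cx; rewrite leNgt xM.
Qed.

Lemma test_function_is_derive (psi : R -> R) : test_function psi ->
  forall x : R, is_derive x 1 psi (psi^`()%classic x).
Proof. by move=> [dpsi _] x; rewrite derive1E; apply: derivableP; exact: (dpsi 0%N). Qed.

Lemma test_function_continuous_derive (psi : R -> R) : test_function psi ->
  continuous psi^`()%classic.
Proof.
move=> [dpsi _]; apply: (@is_derive_continuous _ _ psi^`(2)%classic) => x.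
rewrite derive1nS derive1E; apply: derivableP; exact: (dpsi 1%N).
Qed.

Lemma derive1_out u M : (forall x, M < `|x| -> u x = 0) ->
  forall x, M < `|x| -> u^`()%classic x = 0.
Proof.
move=> u0 x xM; rewrite derive1E (@near_eq_derive _ _ _ _ (fun=> 0)) ?derive_cst//.
near=> y; apply: u0; near: y.
have : {for x, continuous (@Num.norm R R)} by exact: norm_continuous.
by move=> /(_ _ (lt_nbhsr xM)).
Unshelve. all: by end_near. Qed.

(** Integration by parts: the derivative of F psi integrates to 0 over an interval at whose end
    points psi vanishes. *)
Lemma C1_weak_derive F f : (forall x : R, is_derive x 1 F (f x)) -> continuous f ->
  is_weak_derive F f.
Proof.
move=> dF cf; have cF := is_derive_continuous dF.
split; [exact: continuous_locally_integrable..|].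
move=> psi tpsi; have [M psiM] := test_function_support tpsi.
have dpsi := test_function_is_derive tpsi.
have cpsi := is_derive_continuous dpsi.
have cdpsi := test_function_continuous_derive tpsi.
have dpsiM := derive1_out psiM.
(* [L] is positive and strictly larger than [M], so psi vanishes at both end points of [-L, L]. *)
pose L := `|M| + 1.
have outL x : x \notin `[- L, L] -> M < `|x|.
  rewrite in_itv/= -ler_norml -ltNge => /(lt_trans _); apply.
  by rewrite (le_lt_trans (ler_norm M))// ltrDl.
have cc (u v : R -> R) : continuous u -> continuous v ->
    mu.-integrable `[- L, L] (EFin \o (fun x => u x * v x)).
  move=> cu cv; apply: locally_integrable_itv; apply: continuous_locally_integrable.
  by move=> x; apply: continuousM; [exact: cu|exact: cv].
rewrite (@Rintegral_support _ (- L) L) => [|x /outL/dpsiM ->]; last by rewrite mulr0.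
rewrite (@Rintegral_support (fun x => f x * psi x) (- L) L) => [|x /outL/psiM ->];
  last by rewrite mulr0.
apply/eqP; rewrite -subr_eq0 opprK -RintegralD//; [|exact: cc..].
have LL : - L <= L by rewrite ge0_cp// addr_ge0.
have dFp (x : R) : is_derive x 1 (fun x => F x * psi x)
    (F x * psi^`()%classic x + f x * psi x).
  apply: (is_derive_eq (is_deriveM (dF x) (dpsi x))).
  by rewrite /GRing.scale/= (mulrC (psi x)).
rewrite (FTC2_Rintegral LL dFp).
- have ML : M < `|L|.
    by rewrite ger0_norm ?addr_ge0// (le_lt_trans (ler_norm M))// ltrDl.
  by rewrite !psiM ?normrN// !mulr0 subrr.
- by move=> x; apply: cvgD; apply: cvgM;
    [exact: cF|exact: cdpsi|exact: cf|exact: cpsi].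
Qed.

(** Measurability of [h] is a separate premise because equality outside a null set does not make a
    function Borel. *)
Lemma is_weak_derive_ae f g h : is_weak_derive f g -> measurable_fun setT h ->
  {ae mu, forall x, f x = h x} -> is_weak_derive h g.
Proof.
move=> [[mf _ lf] lg fg] mh fh; split => //.
  split => //; first exact: openT.
  move=> K KT cK; have := lf _ KT cK; congr (_ < _)%E.
  apply: ae_eq_integral.
  - exact: compact_measurable.
  - by apply/measurable_EFinP/measurableT_comp => //; exact: measurable_funTS.
  - by apply/measurable_EFinP/measurableT_comp => //; exact: measurable_funTS.
  - by apply: ae_imp fh => x -> _.
move=> psi tpsi; rewrite -fg//; congr fine.
have mpsi : measurable_fun setT psi^`()%classic.
  by apply: continuous_measurable_fun; exact: test_function_continuous_derive.
apply: ae_eq_integral => //.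
- by apply/measurable_EFinP; exact: measurable_funM.
- by apply/measurable_EFinP; exact: measurable_funM.
- by apply: ae_imp fh => x -> _.
Qed.

(** A plateau equal to 1 on [-n, n] and 0 outside [-n-1, n+1]. The last argument 0 keeps both ramps
    of width 1, so the derivatives are bounded uniformly in [n]. *)
Definition cutoff n : R -> R := tent (- n.+1%:R) n%:R 0.

Lemma cutoff_itv n : - n.+1%:R < n%:R :> R.
Proof. by rewrite (@lt_le_trans _ _ 0)// oppr_lt0. Qed.

Lemma cutoff_norm_le1 n x : `|cutoff n x| <= 1.
Proof.
apply: (le_trans (tent_le _ _ (cutoff_itv n))).
by rewrite indicE lern1 leq_b1.
Qed.

Lemma cutoff_near1 x : \forall n \near \oo, cutoff n x = 1.
Proof.
near=> n.
have xn : `|x| <= n%:R by near: n; exact: nbhs_infty_ger.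
move: xn; rewrite ler_norml => /andP[nx xn].
by rewrite /cutoff /tent ramp1 ?ramp0 ?mulr0 ?addr0// invr1 -natr1 opprD subrK.
Unshelve. all: by end_near. Qed.

Lemma cutoff_cvg x : cutoff n x @[n --> \oo] --> (1 : R).
Proof. by apply: cvg_near_cst; exact: cutoff_near1. Qed.

Lemma derive_cutoffE n x : (cutoff n)^`()%classic x =
  (ramp (- n.+1%:R) 0)^`()%classic x - (ramp n%:R 0)^`()%classic x.
Proof. by rewrite (is_derive_derive1 (tent_is_derive _ _ _)). Qed.

Lemma derive_cutoff_le C n x : 0 < C -> (forall x : R, `|step^`()%classic x| <= C) ->
  `|(cutoff n)^`()%classic x| <= 2 * C.
Proof.
move=> C0 dC; rewrite derive_cutoffE.
have H a : `|(ramp a 0)^`()%classic x| <= C.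
  apply: (le_trans (derive_ramp_le a 0 x dC)).
  rewrite mulr1; apply: ler_piMr; first exact: ltW.
  by rewrite indicE lern1 leq_b1.
by rewrite (le_trans (ler_normB _ _))// mulrDl mul1r lerD.
Qed.

Lemma derive_cutoff_cvg x : (cutoff n)^`()%classic x @[n --> \oo] --> (0 : R).
Proof.
have [C C0 dC] := @dstep_bounded R.
apply: cvg_near_cst; near=> n; rewrite derive_cutoffE.
have xn : `|x| < n%:R by near: n; exact: nbhs_infty_gtr.
move: xn; rewrite ltr_norml => /andP[nx xn].
have H a : x \notin `[a, a + 1] -> (ramp a 0)^`()%classic x = 0.
  move=> xa; have := derive_ramp_le a 0 x dC; rewrite invr1 indicE.
  by rewrite mem_setE (negbTE xa) mulr0 normr_le0 => /eqP.
rewrite !H ?subrr//.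
  by rewrite in_itv/= negb_and -!ltNge xn.
by rewrite in_itv/= negb_and -!ltNge -natr1 opprD subrK nx orbT.
Unshelve. all: by end_near. Qed.

Lemma continuous_derive_cutoff n : continuous (cutoff n)^`()%classic.
Proof.
have -> : (cutoff n)^`()%classic =
    fun x => (ramp (- n.+1%:R) 0)^`()%classic x - (ramp n%:R 0)^`()%classic x.
  by apply/funext => x; exact: derive_cutoffE.
by move=> x; apply: cvgB; exact: continuous_derive_ramp.
Qed.

Lemma is_derive_cutoff n (x : R) : is_derive x 1 (cutoff n) ((cutoff n)^`()%classic x).
Proof. by rewrite derive_cutoffE; exact: tent_is_derive. Qed.

Lemma cutoff_pdf_is_derive n (x : R) : is_derive x 1 (fun x => cutoff n x * phi x)
  (((cutoff n)^`()%classic x - x * cutoff n x) * phi x).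
Proof.
apply: (is_derive_eq (is_deriveM (is_derive_cutoff n x) (is_derive_normal_pdf x))).
by rewrite /GRing.scale/=; ring.
Qed.

Lemma cutoff_pdf_test n : test_function (fun x => cutoff n x * phi x).
Proof.
apply: (@smooth_test_function _ _ n.+1%:R).
  move=> k; apply: CkM; last exact: smooth_normal_pdf.
  apply: CkD; first exact: smooth_ramp.
  by apply: CkM; [exact: Ck_cst|exact: smooth_ramp].
move=> x xn; rewrite /cutoff tent_out ?mul0r ?cutoff_itv//.
by rewrite natr1 in_itv/= -ler_norml -ltNge.
Qed.

(** The weak identity is tested against [cutoff n] times [phi], whose derivative tends to -x phi;
    dominated convergence applies on both sides. *)
Lemma stein f g : is_weak_derive f g -> N.-integrable setT (EFin \o f) ->
  N.-integrable setT (EFin \o (fun x => x * f x)) -> N.-integrable setT (EFin \o g) ->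
  \int[N]_x g x = \int[N]_x (x * f x).
Proof.
move=> [[mf _ _] [mg _ _] fg] iF ixF iG.
have [C C0 dC] := @dstep_bounded R.
have mphi := @measurable_normal_pdf R 0 1.
have mid : measurable_fun setT (fun x : R => x) by exact: measurable_id.
have mcut n : measurable_fun setT (cutoff n).
  by apply: continuous_measurable_fun; exact: (is_derive_continuous (is_derive_cutoff n)).
have mdcut n : measurable_fun setT (cutoff n)^`()%classic.
  by apply: continuous_measurable_fun; exact: continuous_derive_cutoff.
have cR : \int[mu]_x (g x * (cutoff n x * phi x)) @[n --> \oo] --> \int[mu]_x (g x * phi x).
  apply: (@Rintegral_dominated_cvg _ _ _ mu _ _ (fun x => `|g x * phi x|)).
  - by move=> n; exact: (measurable_funM mg (measurable_funM (mcut n) mphi)).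
  - move=> x; apply: cvgMr; rewrite -[X in _ --> X]mul1r; apply: cvgMl.
    exact: cutoff_cvg.
  - rewrite (_ : EFin \o _ = abse \o (EFin \o (fun x => g x * phi x)))//.
    by apply: integrable_abse; exact/integrable_normal_prob.
  - move=> n x; rewrite !normrM ler_wpM2l// ler_piMl//.
    exact: cutoff_norm_le1.
have cL : \int[mu]_x (f x * (fun x => cutoff n x * phi x)^`()%classic x) @[n --> \oo] -->
    \int[mu]_x (- 1 * (x * f x * phi x)).
  apply: (@Rintegral_dominated_cvg _ _ _ mu _ _
      (fun x => 2 * C * `|f x * phi x| + `|x * f x * phi x|)).
  - move=> n; rewrite (is_derive_derive1 (cutoff_pdf_is_derive n)).
    apply: measurable_funM => //; apply: measurable_funM => //.
    exact: (measurable_funB (mdcut n) (measurable_funM mid (mcut n))).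
  - move=> x.
    rewrite [X in X @ _](_ : _ = fun n => f x * (((cutoff n)^`()%classic x - x * cutoff n x) * phi x)).
      rewrite (_ : -1 * (x * f x * phi x) = f x * ((0 - x * 1) * phi x)); last by ring.
      apply: cvgMr; apply: cvgMl; apply: cvgB; first exact: derive_cutoff_cvg.
      by apply: cvgMr; exact: cutoff_cvg.
    by apply/funext => n; rewrite (is_derive_derive1 (cutoff_pdf_is_derive n)).
  - rewrite (_ : EFin \o _ = (fun x => (2 * C)%:E * `|(EFin \o (fun x => (f x * phi x)%R)) x|) \+
      (abse \o (EFin \o (fun x => (x * f x * phi x)%R))))%E//.
    apply: integrableD => //.
      by apply: integrableZl => //; apply: integrable_abse; exact/integrable_normal_prob.
    apply: integrable_abse; apply/integrable_normal_prob => //.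
    exact: measurable_funM.
  - move=> n x; rewrite (is_derive_derive1 (cutoff_pdf_is_derive n)).
    rewrite mulrA mulrBr mulrBl (le_trans (ler_normB _ _))//; apply: lerD.
      rewrite -mulrA (mulrC _ (phi x)) mulrA normrM mulrC ler_wpM2r//.
      exact: derive_cutoff_le.
    rewrite (_ : f x * (x * cutoff n x) * phi x = (x * f x * phi x) * cutoff n x); last by ring.
    by rewrite normrM ler_piMr// cutoff_norm_le1.
have E : \int[mu]_x (- 1 * (x * f x * phi x)) = - \int[mu]_x (g x * phi x).
  apply: (cvg_unique _ cL); first exact: norm_hausdorff.
  rewrite (_ : (fun n => _) = fun n => - \int[mu]_x (g x * (cutoff n x * phi x))).
    exact: cvgN.
  by apply/funext => n; rewrite fg//; exact: cutoff_pdf_test.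
rewrite !Rintegral_normal_prob//.
apply: oppr_inj; rewrite -E RintegralZl ?mulN1r//.
by apply/integrable_normal_prob => //; exact: measurable_funM.
Qed.

End stein.

(** * Gaussian moments up to degree four *)

Section normal_moments.
Context {R : realType}.
Local Notation mu := (@lebesgue_measure R).
Local Notation N := (@normal_prob R 0 1).
Local Notation phi := (@normal_pdf R 0 1).
Implicit Types f g u F : R -> R.

(* exp(y) >= y^2/2 at y = 3x^2/8 trades the factor x^4 for a larger variance. *)
Lemma quartic_normal_pdf_le : exists2 c : R, 0 <= c &
  forall x, x ^+ 4 * phi x <= c * normal_pdf 0 2 x.
Proof.
have two0 : (2 : R) != 0 by [].
pose k : R := @normal_peak R 1; pose l : R := @normal_peak R 2.
have k0 : 0 < k by exact: normal_peak_gt0.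
have l0 : 0 < l by exact: normal_peak_gt0.
exists (128 / 9 * (k / l)); first by rewrite !mulr_ge0// ?invr_ge0// ltW.
move=> x; rewrite normal_pdf01E (normal_pdfE _ two0) /normal_fun -/k -/l subr0.
have y0 : 0 <= 3 / 8 * x ^+ 2 by rewrite mulr_ge0// sqr_ge0.
have := expR_ge1Dxn 1 y0; set y := 3 / 8 * x ^+ 2 => H.
have x4 : x ^+ 4 <= 128 / 9 * expR y.
  have -> : x ^+ 4 = 128 / 9 * (y ^+ 2 / 2) by rewrite /y; field.
  rewrite ler_pM2l//; apply: le_trans H.
  by rewrite (_ : 2`!%:R = 2)// lerDr.
have -> : expR (- x ^+ 2 / (2 ^+ 2 *+ 2)) = expR y * expR (- (x ^+ 2 / 2)).
  by rewrite -expRD; congr expR; rewrite /y; field.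
have -> : 128 / 9 * (k / l) * (l * (expR y * expR (- (x ^+ 2 / 2)))) =
  128 / 9 * expR y * (k * expR (- (x ^+ 2 / 2))).
  by field; rewrite gt_eqF.
by rewrite ler_wpM2r// mulr_ge0 ?expR_ge0// ltW.
Qed.

Lemma integrable_normal_quartic u c : measurable_fun setT u ->
  (forall x, `|u x| <= c * (1 + x ^+ 4)) -> N.-integrable setT (EFin \o u).
Proof.
move=> mum uc; apply/integrable_normal_prob => //.
have mphi := @measurable_normal_pdf R 0 1.
have [k k0 kphi] := quartic_normal_pdf_le.
have i1 : mu.-integrable setT (EFin \o (fun x => `|c| * phi x)).
  by apply: integrableMlr => //; exact: integrable_normal_pdf.
have i2 : mu.-integrable setT (EFin \o (fun x => `|c| * k * normal_pdf 0 2 x)).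
  by apply: integrableMlr => //; exact: integrable_normal_pdf.
apply: le_integrable (integrableD _ i1 i2) => //.
  by apply/measurable_EFinP; exact: measurable_funM.
move=> x _ /=; rewrite lee_fin.
rewrite (@ger0_norm _ (_ + _)); last first.
  by rewrite addr_ge0// ?mulr_ge0// normal_pdf_ge0.
rewrite normrM (ger0_norm (normal_pdf_ge0 _ _ _)).
have H : `|u x| <= `|c| * (1 + x ^+ 4).
  apply: (le_trans (uc x)); apply: ler_wpM2r; last exact: ler_norm.
  by rewrite addr_ge0// exprn_even_ge0.
apply: (@le_trans _ _ (`|c| * (1 + x ^+ 4) * phi x)).
  by rewrite ler_wpM2r// normal_pdf_ge0.
have -> : `|c| * (1 + x ^+ 4) * phi x = `|c| * phi x + `|c| * (x ^+ 4 * phi x) by ring.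
by rewrite lerD2l -mulrA ler_wpM2l.
Qed.

Lemma expr_quartic_le (x : R) k : (k <= 4)%N -> `|x ^+ k| <= 1 * (1 + x ^+ 4).
Proof.
move=> k4; rewrite normrX mul1r.
have -> : x ^+ 4 = `|x| ^+ 4 by rewrite -normrX ger0_norm// exprn_even_ge0.
have [x1|x1] := leP `|x| 1.
  by rewrite (@le_trans _ _ 1)// ?exprn_ile1// lerDl exprn_ge0.
by rewrite (@le_trans _ _ (`|x| ^+ 4))// ?ler_weXn2l// ?ltW// ltrDr.
Qed.

Lemma integrable_normal_expr k : (k <= 4)%N ->
  N.-integrable setT (EFin \o (fun x : R => x ^+ k)).
Proof.
move=> k4; apply: (@integrable_normal_quartic _ 1).
  exact: measurable_funX.
by move=> x; exact: expr_quartic_le.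
Qed.

Lemma is_weak_derive_expr k : is_weak_derive (fun x : R => x ^+ k) (fun x => k%:R * x ^+ k.-1).
Proof.
apply: C1_weak_derive.
  move=> x; have -> : (fun x : R => x ^+ k) = id ^+ k by apply/funext => y; rewrite exprfctE.
  apply: (is_derive_eq (is_deriveX k (is_derive_id x 1))).
  by rewrite /GRing.scale/= mulr1.
move=> x; apply: cvgMr; exact: exprn_continuous.
Qed.

(** Stein's identity for x^k. At k = 0 the truncated predecessor is harmless, being multiplied by
    0. *)
Lemma normal_moment_rec k : (k < 4)%N ->
  \int[N]_x (x ^+ k.+1) = k%:R * \int[N]_x (x ^+ k.-1).
Proof.
move=> k4.
have ik : N.-integrable setT (EFin \o (fun x : R => x ^+ k.-1)).
  by apply: integrable_normal_expr; rewrite (leq_trans (leq_pred k))// ltnW.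
rewrite -RintegralZl//.
rewrite (stein (is_weak_derive_expr k)).
- by apply: eq_Rintegral => x _; rewrite exprS.
- by apply: integrable_normal_expr; rewrite ltnW.
- rewrite (_ : (fun x : R => _) = fun x => x ^+ k.+1); first exact: integrable_normal_expr.
  by apply/funext => x; rewrite exprS.
- exact: integrableMlr.
Qed.

Lemma normal_moment0 : \int[N]_x (x ^+ 0 : R) = 1.
Proof.
rewrite (_ : \int[N]_x _ = \int[N]_(x in setT) (cst (1 : R)) x); last first.
  by apply: eq_Rintegral => x _; rewrite expr0.
rewrite Rintegral_cst// mul1r.
by rewrite -[RHS]/(fine 1%E); congr fine; exact: probability_setT.
Qed.

Lemma normal_moment1 : \int[N]_x (x ^+ 1 : R) = 0.
Proof. by rewrite normal_moment_rec// mul0r. Qed.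

Lemma normal_moment2 : \int[N]_x (x ^+ 2 : R) = 1.
Proof. by rewrite normal_moment_rec// normal_moment0 mulr1. Qed.

Lemma normal_moment3 : \int[N]_x (x ^+ 3 : R) = 0.
Proof. by rewrite normal_moment_rec// normal_moment1 mulr0. Qed.

Lemma normal_moment4 : \int[N]_x (x ^+ 4 : R) = 3.
Proof. by rewrite normal_moment_rec// normal_moment2 mulr1. Qed.

(** This right-nested form with all five powers is the normal form into which polynomials are
    brought before integration, so that linearity can be applied one summand at a time. *)
Lemma integrable_normal_quartic_sum (c0 c1 c2 c3 c4 : R) :
  N.-integrable setT (EFin \o (fun x =>
  c0 * x ^+ 0 + (c1 * x ^+ 1 + (c2 * x ^+ 2 + (c3 * x ^+ 3 + c4 * x ^+ 4))))).
Proof.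
do ?[apply: integrableDr => //]; apply: integrableMlr => //; exact: integrable_normal_expr.
Qed.

Lemma Rintegral_normal_quartic (c0 c1 c2 c3 c4 : R) :
  \int[N]_x (c0 * x ^+ 0 + (c1 * x ^+ 1 + (c2 * x ^+ 2 + (c3 * x ^+ 3 + c4 * x ^+ 4)))) =
  c0 + c2 + 3 * c4.
Proof.
have I (c : R) k : (k <= 4)%N -> N.-integrable setT (EFin \o (fun x : R => c * x ^+ k)).
  by move=> k4; apply: integrableMlr => //; exact: integrable_normal_expr.
rewrite !RintegralD//; do ?[exact: I|apply: integrableDr => //].
rewrite !RintegralZl//; do ?exact: integrable_normal_expr.
rewrite normal_moment0 normal_moment1 normal_moment2 normal_moment3 normal_moment4.
by ring.
Qed.

Lemma Rintegral_normal_quadratic_sqr (a b c : R) :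
  \int[N]_x ((a * x ^+ 2 + b * x + c) ^+ 2) = 3 * a ^+ 2 + b ^+ 2 + 2 * a * c + c ^+ 2.
Proof.
have -> : (fun x => (a * x ^+ 2 + b * x + c) ^+ 2) = fun x => c ^+ 2 * x ^+ 0 + (2 * b * c * x ^+ 1 +
    ((b ^+ 2 + 2 * a * c) * x ^+ 2 + (2 * a * b * x ^+ 3 + a ^+ 2 * x ^+ 4))).
  by apply/funext => x; ring.
by rewrite Rintegral_normal_quartic; ring.
Qed.

End normal_moments.

(** * The sharp inequality for functions vanishing at -1 and 1 *)

Section kernel.
Context {R : realType}.
Local Notation mu := (@lebesgue_measure R).
Local Notation N := (@normal_prob R 0 1).
Local Notation phi := (@normal_pdf R 0 1).
Implicit Types (x t : R) (f g u F : R -> R).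

(* [btw x t] says that t lies between x and the sign of x (for x <> 0). *)
Definition btw x t : bool :=
  [|| (1 <= t) && (t <= x), [&& 0 <= x, x <= t & t <= 1],
      (x <= t) && (t <= - 1) | [&& - 1 <= t, t <= x & x <= 0]].

Lemma is_derive_id_pdf (x : R) :
  is_derive x 1 (fun x : R => x * phi x) ((1 - x ^+ 2) * phi x).
Proof.
apply: (is_derive_eq (is_deriveM (is_derive_id x 1) (is_derive_normal_pdf x))).
by rewrite /GRing.scale/=; ring.
Qed.

Lemma is_derive_Nid_pdf (x : R) :
  is_derive x 1 (fun x : R => - (x * phi x)) ((x ^+ 2 - 1) * phi x).
Proof.
by apply: (is_derive_eq (is_deriveN (is_derive_id_pdf x))); ring.
Qed.

Lemma continuous_quadratic_pdf (a b : R) : continuous (fun x : R => (a * x ^+ 2 + b) * phi x).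
Proof.
move=> x; apply: cvgM; last exact: continuous_normal_pdf01.
apply: cvgD; last exact: cvg_cst.
by apply: cvgMr; exact: exprn_continuous.
Qed.

Lemma cvg_Nid_pdf : - (x * phi x) @[x --> +oo] --> (0 : R).
Proof.
rewrite -[X in _ --> X]oppr0; apply: cvgN.
have [k k0 kphi] := @quartic_normal_pdf_le R.
pose l : R := @normal_peak R 2.
have Vx : k * l * x^-1 @[x --> +oo] --> (0 : R).
  rewrite -[X in _ --> X](mulr0 (k * l)); apply: cvgMr.
  by apply/gtr0_cvgV0; [exact: nbhs_pinfty_gt|exact: cvg_id].
(* For x >= 1 one has x^2 phi(x) <= x^4 phi(x) <= k l, that is, x phi(x) <= k l / x. *)
apply: (squeeze_cvgr _ (cvg_cst (0 : R)) Vx).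
near=> x.
have x0 : 0 < x by near: x; exact: nbhs_pinfty_gt.
have x1 : 1 <= x by near: x; exact: nbhs_pinfty_ge.
apply/andP; split; first by rewrite mulr_ge0 ?normal_pdf_ge0// ltW.
rewrite ler_pdivlMr//.
apply: (@le_trans _ _ (x ^+ 4 * phi x)).
  rewrite mulrAC ler_wpM2r ?normal_pdf_ge0//.
  by rewrite -expr2 ler_weXn2l.
apply: (le_trans (kphi x)); apply: ler_wpM2l => //.
exact: normal_pdf_ub.
Unshelve. all: by end_near. Qed.

Lemma normal_pdf01N x : phi (- x) = phi x.
Proof. by rewrite !normal_pdf01E sqrrN. Qed.

Lemma integral_quadratic_pdf_y t : 1 <= t ->
  (\int[mu]_(x in `[t, +oo[) (`|x ^+ 2 - 1| * phi x)%:E = (t * phi t)%:E)%E.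
Proof.
move=> t1.
have x21 x : t <= x -> 0 <= x ^+ 2 - 1.
  by move=> tx; rewrite subr_ge0 exprn_ege1// (le_trans t1).
transitivity (\int[mu]_(x in `[t, +oo[) ((x ^+ 2 - 1) * phi x)%:E)%E.
  apply: eq_integral => x; rewrite inE/= in_itv/= andbT => tx.
  by rewrite ger0_norm// x21.
have cF : continuous (fun x : R => - (x * phi x)).
  exact: is_derive_continuous is_derive_Nid_pdf.
rewrite (@ge0_continuous_FTC2y _ _ (fun x : R => - (x * phi x)) _ 0).
- by rewrite -EFinB opprK add0r.
- by move=> x tx; rewrite mulr_ge0 ?normal_pdf_ge0// x21.
- apply: continuous_subspaceT => x.
  have := @continuous_quadratic_pdf 1 (-1) x.
  by rewrite /continuous_at mul1r; under eq_fun do rewrite mul1r.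
- exact: cvg_Nid_pdf.
- by move=> x _; have := is_derive_Nid_pdf x => -[].
- by apply: cvg_at_right_filter; exact: cF.
- by move=> x _; rewrite (is_derive_derive1 is_derive_Nid_pdf).
Qed.

Lemma integral_quadratic_pdf_Ny t : t <= -1 ->
  (\int[mu]_(x in `]-oo, t]) (`|x ^+ 2 - 1| * phi x)%:E = (- t * phi t)%:E)%E.
Proof.
move=> t1; have t1' : 1 <= - t by lra.
rewrite -[in RHS]normal_pdf01N -integral_quadratic_pdf_y// -{1}(opprK t).
rewrite ge0_integration_by_substitutionNy.
- by apply: eq_integral => x _; rewrite /= sqrrN normal_pdf01N.
- apply: continuous_subspaceT => x; apply: cvgM; last exact: continuous_normal_pdf01.
  by apply: cvg_norm; apply: cvgB; [exact: exprn_continuous|exact: cvg_cst].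
- by move=> x _; rewrite mulr_ge0// normal_pdf_ge0.
Qed.

Lemma integral_quadratic_pdf_itv a b : - 1 <= a -> a <= b -> b <= 1 ->
  (\int[mu]_(x in `[a, b]) (`|x ^+ 2 - 1| * phi x)%:E = (b * phi b - a * phi a)%:E)%E.
Proof.
move=> a1 ab b1.
have cf : continuous (fun x : R => (1 - x ^+ 2) * phi x).
  move=> x; have := @continuous_quadratic_pdf (-1) 1 x.
  rewrite /continuous_at mulN1r addrC.
  by under eq_fun do rewrite mulN1r addrC.
transitivity (\int[mu]_(x in `[a, b]) ((1 - x ^+ 2) * phi x)%:E)%E.
  apply: eq_integral => x; rewrite inE/= in_itv/= => /andP[ax xb].
  rewrite distrC ger0_norm// subr_ge0 -[x ^+ 2]ger0_norm ?sqr_ge0// normrX.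
  by rewrite exprn_ile1// ler_norml; apply/andP; split; lra.
rewrite -(FTC2_Rintegral ab is_derive_id_pdf cf) /Rintegral fineK//.
apply: integrable_fin_num => //; apply: locally_integrable_itv.
exact: continuous_locally_integrable.
Qed.

(** For fixed [t] the admissible [x] form the half-line beyond [t] if |t| > 1 and the segment
    between 0 and [t] if |t| < 1; x phi(x) vanishes at the other end in both cases. At t = 1 and t =
    -1 two such sets meet and the value doubles. *)
Lemma integral_btw_kernel t : t != 0 -> t != 1 -> t != -1 ->
  (\int[N]_x (`|x ^+ 2 - 1| * (btw x t)%:R)%:E = (`|t| * phi t)%:E)%E.
Proof.
move=> t0 t1 tN1.
have meas (A : set R) : measurable A ->
    (forall x, btw x t = (x \in A)) ->
    (\int[N]_x (`|x ^+ 2 - 1| * (btw x t)%:R)%:E =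
     \int[mu]_(x in A) (`|x ^+ 2 - 1| * phi x)%:E)%E.
  move=> mA btA.
  have m2 : measurable_fun setT (fun x : R => `|x ^+ 2 - 1|).
    apply: measurableT_comp => //; exact: measurable_funB.
  rewrite ge0_integral_normal_prob.
  - rewrite [RHS]integral_mkcond; apply: eq_integral => x _.
    rewrite patchE -btA; case: (btw x t); first by rewrite mulr1.
    by rewrite mulr0 mul0r.
  - apply: measurable_funM => //.
    rewrite (_ : (fun x => _) = \1_A); first exact: measurable_indic.
    by apply/funext => x; rewrite indicE btA.
  - by move=> x; rewrite mulr_ge0.
have [tp|tn] := ltP 0 t.
  have [t1'|t1'] := ltP 1 t.
    rewrite (meas `[t, +oo[%classic) => [|//|x].
      by rewrite integral_quadratic_pdf_y ?ltW// gtr0_norm.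
    rewrite mem_setE in_itv/= andbT /btw; apply/idP/idP => [|tx].
      by move=> /or4P[/andP[]|/and3P[]|/andP[]|/and3P[]]; lra.
    by apply/or4P/Or41; lra.
  rewrite (meas `[0, t]%classic) => [|//|x].
    by rewrite integral_quadratic_pdf_itv ?mul0r ?subr0 ?gtr0_norm//; lra.
  rewrite mem_setE in_itv/= /btw; apply/idP/idP => [|].
    by move=> /or4P[/andP[]|/and3P[]|/andP[]|/and3P[]]; lra.
  by move=> /andP[x0 xt]; apply/or4P/Or42; apply/and3P; split.
have [t1'|t1'] := ltP t (-1).
  rewrite (meas `]-oo, t]%classic) => [|//|x].
    by rewrite integral_quadratic_pdf_Ny ?ltW// ler0_norm.
  rewrite mem_setE in_itv/= /btw; apply/idP/idP => [|tx].
    by move=> /or4P[/andP[]|/and3P[]|/andP[]|/and3P[]]; lra.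
  by apply/or4P/Or43; lra.
rewrite (meas `[t, 0]%classic) => [|//|x].
  by rewrite integral_quadratic_pdf_itv ?mul0r ?sub0r ?ler0_norm ?mulNr//; lra.
rewrite mem_setE in_itv/= /btw; apply/idP/idP => [|].
  by move=> /or4P[/andP[]|/and3P[]|/andP[]|/and3P[]]; lra.
by move=> /andP[x0 xt]; apply/or4P/Or44; apply/and3P; split.
Qed.

(** The integral I(x) of the overview for u = h'^2. It is written over the whole line with an
    indicator so that Tonelli's theorem applies, and it is extended-real because the weight 1/|t|
    may make it diverge at x = 0. *)
Definition ray (u : R -> R) x : \bar R :=
  (\int[mu]_t ((btw x t)%:R * (u t / (2 * `|t|)))%:E)%E.

Lemma measurable_btw : measurable_fun setT (fun z : R * R => (btw z.1 z.2)%:R : R).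
Proof.
have m1 : measurable_fun setT (fun z : R * R => z.1) by exact: measurable_fst.
have m2 : measurable_fun setT (fun z : R * R => z.2) by exact: measurable_snd.
have mc (c : R) : measurable_fun setT (fun z : R * R => c) by exact: measurable_cst.
rewrite (_ : (fun z => _) = fun z => if btw z.1 z.2 then 1 else 0 : R); last first.
  by apply/funext => z; case: btw.
apply: measurable_fun_ifT => //; rewrite /btw.
apply: measurable_or; first by apply: measurable_and; exact: measurable_fun_ler.
apply: measurable_or.
  apply: measurable_and; first exact: measurable_fun_ler.
  by apply: measurable_and; exact: measurable_fun_ler.
apply: measurable_or; first by apply: measurable_and; exact: measurable_fun_ler.
apply: measurable_and; first exact: measurable_fun_ler.
by apply: measurable_and; exact: measurable_fun_ler.
Qed.

Lemma measurable_inv_weight : measurable_fun setT (fun t => (2 * `|t|)^-1).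
Proof.
rewrite (_ : (fun t => _) = (@powR R)^~ (-1) \o (fun t => 2 * `|t|)); last first.
  by apply/funext => t; rewrite /= powR_inv1// mulr_ge0.
apply: measurableT_comp; first exact: measurable_powR.
by apply: measurable_funM => //; exact: measurableT_comp.
Qed.

Lemma measurable_ray_kernel u : measurable_fun setT u ->
  measurable_fun setT (fun z : R * R =>
    (`|z.1 ^+ 2 - 1| * ((btw z.1 z.2)%:R * (u z.2 / (2 * `|z.2|))))%:E).
Proof.
move=> mum.
have m1 : measurable_fun setT (fun z : R * R => z.1) by exact: measurable_fst.
have m2 : measurable_fun setT (fun z : R * R => z.2) by exact: measurable_snd.
apply/measurable_EFinP; apply: measurable_funM.
  apply: measurableT_comp => //; apply: measurable_funB => //.
  exact: measurable_funX.
apply: measurable_funM; first exact: measurable_btw.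
apply: measurable_funM; first exact: measurableT_comp mum m2.
exact: (measurableT_comp measurable_inv_weight m2).
Qed.

(* The kernel |x^2 - 1| btw(x, t) integrates in x to |t| phi(t), because -x phi(x) is an
   antiderivative of (x^2 - 1) phi(x). *)
Lemma ray_tonelli u : measurable_fun setT u -> (forall t, 0 <= u t) ->
  measurable_fun setT (fun x => (`|x ^+ 2 - 1|%:E * ray u x)%E) /\
  (\int[N]_x (`|x ^+ 2 - 1|%:E * ray u x) = \int[N]_t (u t / 2)%:E)%E.
Proof.
move=> mum u0.
pose f (z : R * R) := (`|z.1 ^+ 2 - 1| * ((btw z.1 z.2)%:R * (u z.2 / (2 * `|z.2|))))%:E.
have mf : measurable_fun setT f by exact: measurable_ray_kernel.
have q0 t : 0 <= u t / (2 * `|t|) by rewrite divr_ge0// mulr_ge0.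
have f0 z : (0 <= f z)%E by rewrite lee_fin !mulr_ge0.
have mq : measurable_fun setT (fun t => u t / (2 * `|t|)).
  by apply: measurable_funM => //; exact: measurable_inv_weight.
have mbx (x : R) : measurable_fun setT (fun t => (btw x t)%:R : R).
  exact: (measurableT_comp measurable_btw (measurable_pair1 x)).
have mbt (t : R) : measurable_fun setT (fun x => (btw x t)%:R : R).
  exact: (measurableT_comp measurable_btw (measurable_pair2 t)).
have inner x : (\int[mu]_t f (x, t) = `|x ^+ 2 - 1|%:E * ray u x)%E.
  rewrite /f /=; under eq_integral do rewrite EFinM.
  rewrite ge0_integralZl//.
  - by apply/measurable_EFinP; exact: (measurable_funM (mbx x) mq).
  - by move=> t _; rewrite lee_fin mulr_ge0.
split.
  rewrite (_ : (fun x => _) = fun x => (\int[mu]_t f (x, t))%E).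
    exact: (measurable_fun_fubini_tonelli_F (m2 := mu)).
  by apply/funext => x; rewrite inner.
under eq_integral do rewrite -inner.
rewrite (@fubini_tonelli _ _ _ _ _ N mu f mf f0).
rewrite ge0_integral_normal_prob; last 2 first.
- exact: measurable_funM.
- by move=> t; rewrite divr_ge0.
(* Off these three points the inner integral |t| phi(t) cancels the weight 2|t| up to the factor
   1/2. *)
have mt0 : {ae mu, forall t, [/\ t != 0, t != 1 & t != -1]}.
  have aec (c : R) : {ae mu, forall t, t != c}.
    exists [set c]; split; [exact: measurable_set1|exact: lebesgue_measure_set1|].
    by move=> t /=; apply: contra_notP => /eqP.
  have aec2 : {ae mu, forall t, t != 1 /\ t != -1}.
    by apply: ae_imp2 (aec 1) (aec (-1)) => t.
  by apply: ae_imp2 (aec 0) aec2 => t ? [].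
apply: ae_eq_integral => //.
- exact: (measurable_fun_fubini_tonelli_G (m1 := N)).
- apply/measurable_EFinP; apply: measurable_funM; last exact: measurable_normal_pdf.
  exact: measurable_funM.
apply: ae_imp mt0 => t [t0 t1 tN1] _; rewrite /f /=.
transitivity (\int[N]_x ((u t / (2 * `|t|))%:E * (`|x ^+ 2 - 1| * (btw x t)%:R)%:E))%E.
  by apply: eq_integral => x _; rewrite -EFinM; congr EFin; ring.
rewrite ge0_integralZl//.
- rewrite integral_btw_kernel// -EFinM; congr EFin.
  by field; rewrite normr_eq0.
- apply/measurable_EFinP; apply: measurable_funM; last exact: mbt.
  by apply: measurableT_comp => //; exact: measurable_funB.
- by rewrite lee_fin.
Qed.

End kernel.

(** * The Cauchy-Schwarz inequality with weight 2|t| away from 0, and its equality case *)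

Section weighted_cauchy_schwarz.
Context {R : realType}.
Local Notation mu := (@lebesgue_measure R).
Local Notation N := (@normal_prob R 0 1).
Local Notation phi := (@normal_pdf R 0 1).
Implicit Types (a b x y t : R) (f g h u F : R -> R).

Lemma integrable_normal_itv u a b : N.-integrable setT (EFin \o u) ->
  mu.-integrable `[a, b] (EFin \o u).
Proof.
move=> iu; have mum : measurable_fun setT u by apply/measurable_EFinP; exact: measurable_int iu.
have iup : mu.-integrable setT (EFin \o (fun x => u x * phi x)).
  exact/integrable_normal_prob.
(* A lower bound for [phi] on [a, b], since x^2 <= a^2 + b^2 there whatever the signs of [a] and
   [b]. *)
pose m : R := @normal_peak R 1 * expR (- ((a ^+ 2 + b ^+ 2) / 2)).
have m0 : 0 < m by rewrite mulr_gt0 ?expR_gt0// normal_peak_gt0// oner_neq0.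
have iab : mu.-integrable `[a, b] (EFin \o (fun x => m^-1 * (u x * phi x))).
  by apply: (integrableS measurableT) => //; exact: integrableMlr.
apply: le_integrable iab => //.
  by apply/measurable_EFinP; exact: measurable_funTS.
move=> x /=; rewrite in_itv/= => /andP[ax xb]; rewrite lee_fin.
rewrite normrM normrM (gtr0_norm (normal_pdf01_gt0 x)) gtr0_norm ?invr_gt0//.
rewrite mulrC -mulrA ler_peMr// -[_ / _]mulrC ler_pdivlMl// mulr1.
rewrite normal_pdf01E /m ler_wpM2l ?normal_peak_ge0// ler_expR lerN2 ler_pM2r//.
have [x0|x0] := leP 0 x.
  by apply: (@le_trans _ _ (b ^+ 2)); [rewrite lerXn2r ?nnegrE//; lra|rewrite lerDr sqr_ge0].
apply: (@le_trans _ _ (a ^+ 2)); last by rewrite lerDl sqr_ge0.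
by rewrite -[x ^+ 2]sqrrN -[a ^+ 2]sqrrN lerXn2r ?nnegrE//; lra.
Qed.

Lemma integrable_weight u a b : 0 < a \/ b < 0 -> measurable_fun setT u ->
  mu.-integrable `[a, b] (EFin \o u) ->
  mu.-integrable `[a, b] (EFin \o (fun t => u t / (2 * `|t|))).
Proof.
move=> ab0 mum iu.
have [m m0 Hm] : exists2 m, 0 < m & forall t, a <= t -> t <= b -> m <= `|t|.
  case: ab0 => [a0|b0].
    by exists a => // t at_ tb; rewrite gtr0_norm//; lra.
  by exists (- b); [lra|move=> t at_ tb; rewrite ltr0_norm//; lra].
have iab : mu.-integrable `[a, b] (EFin \o (fun x => (2 * m)^-1 * u x)).
  rewrite (_ : EFin \o _ = fun x => ((2 * m)^-1%:E * (EFin \o u) x)%E)//.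
  exact: integrableZl.
apply: le_integrable iab => //.
  apply/measurable_EFinP; apply: measurable_funTS; apply: measurable_funM => //.
  exact: measurable_inv_weight.
move=> t /=; rewrite in_itv/= => /andP[at_ tb]; rewrite lee_fin !normrM mulrC.
rewrite ler_wpM2r// !normfV lef_pV2 ?posrE ?normr_gt0 ?mulf_neq0 ?normr_eq0//; last 2 first.
- by rewrite -normr_gt0 (lt_le_trans m0)// Hm.
- by rewrite gt_eqF.
by rewrite !normrM normr_id ler_wpM2l// (gtr0_norm m0) Hm.
Qed.

Lemma Rintegral_weight a b : a <= b -> 0 < a \/ b < 0 ->
  \int[mu]_(t in `[a, b]) (2 * `|t|) = `|b ^+ 2 - a ^+ 2|.
Proof.
move=> ab ab0.
have dsq (c x : R) : is_derive x 1 (fun x => c * (x * x)) (c * (x + x)).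
  apply: (is_derive_eq (is_deriveM (is_derive_cst c x 1)
      (is_deriveM (is_derive_id x 1) (is_derive_id x 1)))).
  by rewrite scaler0 addr0 /GRing.scale/= mulr1.
have csq (c : R) : continuous (fun x => c * (x + x)).
  by move=> x; apply: cvgMr; apply: cvgD; exact: cvg_id.
case: ab0 => [a0|b0].
  transitivity (\int[mu]_(t in `[a, b]) (1 * (t + t))).
    apply: eq_Rintegral => t; rewrite inE/= in_itv/= => /andP[at_ tb].
    by rewrite gtr0_norm; [ring|lra].
  rewrite (FTC2_Rintegral ab (dsq 1) (csq 1)) ger0_norm; first by ring.
  by rewrite subr_ge0 lerXn2r ?nnegrE//; lra.
transitivity (\int[mu]_(t in `[a, b]) (-1 * (t + t))).
  apply: eq_Rintegral => t; rewrite inE/= in_itv/= => /andP[at_ tb].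
  by rewrite ltr0_norm; [ring|lra].
rewrite (FTC2_Rintegral ab (dsq (-1)) (csq (-1))) ler0_norm; first by ring.
by rewrite subr_le0 -[b ^+ 2]sqrrN -[a ^+ 2]sqrrN lerXn2r ?nnegrE//; lra.
Qed.

(* Cauchy-Schwarz for g = (g / sqrt w) sqrt w with w(t) = 2|t|, whose integral over [a, b]
   is |b^2 - a^2|. *)
Lemma cauchy_schwarz_itv h g a b : antiderivative h g -> a <= b -> 0 < a \/ b < 0 ->
  mu.-integrable `[a, b] (EFin \o (fun t => g t ^+ 2)) ->
  (h b - h a) ^+ 2 <= `|b ^+ 2 - a ^+ 2| *
    \int[mu]_(t in `[a, b]) (g t ^+ 2 / (2 * `|t|)).
Proof.
move=> [lg hg]; rewrite le_eqVlt => /predU1P[<- _ _|ab ab0 ig2].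
  by rewrite !subrr expr0n normr0 mul0r.
have [mg _ _] := lg; have ab' := ltW ab.
have mg2 : measurable_fun setT (fun t => g t ^+ 2) by exact: measurable_funX.
have i1 := integrable_weight ab0 mg2 ig2.
set I := \int[mu]_(t in _) _.
have W0 : 0 < `|b ^+ 2 - a ^+ 2|.
  rewrite normr_gt0 subr_eq0 eqf_sqr negb_or; apply/andP; split; first by rewrite gt_eqF.
  by case: ab0 => ?; apply/eqP; lra.
set W := `|_| in W0 *.
(* This [l] minimizes the integral of (g - l w)^2 / w, which equals I - 2 l (h b - h a) + l^2 W; the
   minimum is I - (h b - h a)^2 / W. *)
pose l := (h b - h a) / W.
have i2 : mu.-integrable `[a, b] (EFin \o (fun t => (- 2 * l) * g t)).
  rewrite (_ : EFin \o _ = fun x => ((- 2 * l)%:E * (EFin \o g) x)%E)//.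
  by apply: integrableZl => //; exact: locally_integrable_itv.
have iw : mu.-integrable `[a, b] (EFin \o (fun t => 2 * `|t|)).
  apply: locally_integrable_itv; apply: continuous_locally_integrable => x.
  by apply: cvgMr; exact: norm_continuous.
have i3 : mu.-integrable `[a, b] (EFin \o (fun t => l ^+ 2 * (2 * `|t|))).
  rewrite (_ : EFin \o _ = fun x => ((l ^+ 2)%:E * (EFin \o (fun t => (2 * `|t|)%R)) x)%E)//.
  exact: integrableZl.
have : 0 <= \int[mu]_(t in `[a, b]) ((g t - l * (2 * `|t|)) ^+ 2 / (2 * `|t|)).
  by apply: Rintegral_ge0 => t _; rewrite divr_ge0 ?sqr_ge0// mulr_ge0.
have -> : \int[mu]_(t in `[a, b]) ((g t - l * (2 * `|t|)) ^+ 2 / (2 * `|t|)) =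
    \int[mu]_(t in `[a, b]) (g t ^+ 2 / (2 * `|t|) + ((- 2 * l) * g t + l ^+ 2 * (2 * `|t|))).
  apply: eq_Rintegral => t; rewrite inE/= in_itv/= => /andP[at_ tb].
  have t0 : `|t| != 0.
    by rewrite normr_eq0; case: ab0 => ?; apply/eqP; lra.
  by field.
have i23 : mu.-integrable `[a, b] (EFin \o (fun t => (- 2 * l) * g t + l ^+ 2 * (2 * `|t|))).
  by apply: integrableDr.
rewrite (RintegralD _ i1 i23)// (RintegralD _ i2 i3)//.
rewrite (@RintegralZl _ _ _ mu `[a, b] g)//; last exact: locally_integrable_itv.
rewrite (@RintegralZl _ _ _ mu `[a, b] (fun t => 2 * `|t|))//.
rewrite -hg// Rintegral_weight// -/I -/W => H.
have {}H : 0 <= I - (h b - h a) ^+ 2 / W.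
  apply: (le_trans H); rewrite /l le_eqVlt; apply/orP; left; apply/eqP.
  by field; rewrite gt_eqF.
by move: H; rewrite subr_ge0 ler_pdivrMr// mulrC.
Qed.

(* Equality on [a, b] forces equality on [a, y] and [y, b] with the same ratio. *)
Lemma cauchy_schwarz_itv_eq h g a b y : antiderivative h g ->
  a <= y -> y <= b -> 0 < a \/ b < 0 ->
  mu.-integrable `[a, b] (EFin \o (fun t => g t ^+ 2)) ->
  (h b - h a) ^+ 2 = `|b ^+ 2 - a ^+ 2| *
    \int[mu]_(t in `[a, b]) (g t ^+ 2 / (2 * `|t|)) ->
  (h y - h a) * (b ^+ 2 - a ^+ 2) = (h b - h a) * (y ^+ 2 - a ^+ 2).
Proof.
move=> hg ay yb ab0 ig2; have [[mg _ _] _] := hg.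
have mg2 : measurable_fun setT (fun t => g t ^+ 2) by exact: measurable_funX.
have ay0 : 0 < a \/ y < 0 by case: ab0; [left|right; lra].
have yb0 : 0 < y \/ b < 0 by case: ab0; [left; lra|right].
have ig2l : mu.-integrable `[a, y] (EFin \o (fun t => g t ^+ 2)).
  apply: integrableS ig2 => // t /=; rewrite !in_itv/= => /andP[-> ty].
  exact: le_trans yb.
have ig2r : mu.-integrable `[y, b] (EFin \o (fun t => g t ^+ 2)).
  apply: integrableS ig2 => // t /=; rewrite !in_itv/= => /andP[yt ->].
  by rewrite andbT (le_trans ay).
have := cauchy_schwarz_itv hg ay ay0 ig2l.
have := cauchy_schwarz_itv hg yb yb0 ig2r.
rewrite (Rintegral_itvD ay yb (integrable_weight ab0 mg2 ig2)).
set I1 := \int[mu]_(t in `[a, y]) _; set I2 := \int[mu]_(t in `[y, b]) _.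
(* [s] is the side of 0 on which [a, b] lies; it removes the absolute values for both sides at
   once. *)
have [s [s1 sA sB]] : exists s : R, [/\ s * s = 1, `|y ^+ 2 - a ^+ 2| = s * (y ^+ 2 - a ^+ 2)
    & `|b ^+ 2 - y ^+ 2| = s * (b ^+ 2 - y ^+ 2)].
  case: ab0 => ?; [exists 1|exists (-1)]; split; rewrite ?mulr1 ?mulN1r ?opprK ?mul1r//.
  - by rewrite ger0_norm// subr_ge0 lerXn2r ?nnegrE//; lra.
  - by rewrite ger0_norm// subr_ge0 lerXn2r ?nnegrE//; lra.
  - by rewrite ler0_norm// subr_le0 -[y ^+ 2]sqrrN -[a ^+ 2]sqrrN lerXn2r ?nnegrE//; lra.
  - by rewrite ler0_norm// subr_le0 -[y ^+ 2]sqrrN -[b ^+ 2]sqrrN lerXn2r ?nnegrE//; lra.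
have sAB : `|b ^+ 2 - a ^+ 2| = `|y ^+ 2 - a ^+ 2| + `|b ^+ 2 - y ^+ 2|.
  case: ab0 => ?.
    rewrite !ger0_norm ?subr_ge0 ?lerXn2r ?nnegrE//; lra.
  rewrite !ler0_norm ?subr_le0; last 3 first.
  - by rewrite -[y ^+ 2]sqrrN -[b ^+ 2]sqrrN lerXn2r ?nnegrE//; lra.
  - by rewrite -[y ^+ 2]sqrrN -[a ^+ 2]sqrrN lerXn2r ?nnegrE//; lra.
  - by rewrite -[b ^+ 2]sqrrN -[a ^+ 2]sqrrN lerXn2r ?nnegrE//; lra.
  by ring.
rewrite sAB.
have := normr_ge0 (y ^+ 2 - a ^+ 2); have := normr_ge0 (b ^+ 2 - y ^+ 2).
rewrite sA sB; set A := s * (y ^+ 2 - a ^+ 2); set B := s * (b ^+ 2 - y ^+ 2).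
set p := h y - h a; set q := h b - h y => B0 A0 qB pA pq.
have E : (p + q) ^+ 2 = (A + B) * (I1 + I2) by rewrite -pq /p /q; congr (_ ^+ 2); ring.
(* The square of p B - q A equals the defect of Cauchy-Schwarz on [a, b], which is 0, minus
   nonnegative multiples of the defects on [a, y] and [y, b]. So it is at most 0. *)
have pqAB : p * B = q * A.
  apply/eqP; rewrite -subr_eq0 -sqrf_eq0 eq_le sqr_ge0 andbT.
  have H1 : 0 <= B * (A * I1 - p ^+ 2) * (A + B).
    by apply: mulr_ge0; [apply: mulr_ge0|apply: addr_ge0]; rewrite ?subr_ge0.
  have H2 : 0 <= A * (B * I2 - q ^+ 2) * (A + B).
    by apply: mulr_ge0; [apply: mulr_ge0|apply: addr_ge0]; rewrite ?subr_ge0.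
  have -> : (p * B - q * A) ^+ 2 =
     A * B * ((A + B) * (I1 + I2) - (p + q) ^+ 2)
     - B * (A * I1 - p ^+ 2) * (A + B) - A * (B * I2 - q ^+ 2) * (A + B) by ring.
  by rewrite E subrr mulr0; lra.
have -> : h b - h a = p + q by rewrite /p /q; ring.
have -> : b ^+ 2 - a ^+ 2 = s * (A + B).
  by rewrite /A /B -mulrDr mulrA s1; ring.
have -> : y ^+ 2 - a ^+ 2 = s * A by rewrite /A mulrA s1 mul1r.
have -> : p * (s * (A + B)) = s * (p * A + p * B) by ring.
by rewrite pqAB; ring.
Qed.

End weighted_cauchy_schwarz.

(** * The pointwise bound, its integrated form, and equality region by region *)

Section sharp_inequality.
Context {R : realType}.
Local Notation mu := (@lebesgue_measure R).
Local Notation N := (@normal_prob R 0 1).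
Local Notation phi := (@normal_pdf R 0 1).
Implicit Types (a b x y t : R) (f g h u F : R -> R).

(** This treats the four positions of [x] uniformly: [e] is the zero of x^2 - 1 on the side of [x],
    and the segment between them avoids 0, where the weight degenerates. *)
Lemma btw_itv x : x != 0 -> exists a b e,
  [/\ (a, b) = (x, e) \/ (a, b) = (e, x), e ^+ 2 = 1, a <= b, 0 < a \/ b < 0 &
   forall t, btw x t = (t \in `[a, b])].
Proof.
rewrite neq_lt => /orP[x0|x0].
  have [x1|x1] := leP x (-1).
    exists x, (-1), (-1); split; [by left|by rewrite sqrrN expr1n|by []|by right; lra|].
    move=> t; rewrite in_itv/= /btw; apply/idP/idP => [|].
      by move=> /or4P[/andP[]|/and3P[]|/andP[]|/and3P[]] *; apply/andP; split; lra.
    by move=> tx; apply/or4P/Or43.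
  exists (-1), x, (-1); split; [by right|by rewrite sqrrN expr1n|by lra|by right; lra|].
  move=> t; rewrite in_itv/= /btw; apply/idP/idP => [|].
    by move=> /or4P[/andP[]|/and3P[]|/andP[]|/and3P[]] *; apply/andP; split; lra.
  by move=> /andP[? ?]; apply/or4P/Or44; apply/and3P; split; lra.
have [x1|x1] := leP 1 x.
  exists 1, x, 1; split; [by right|by rewrite expr1n|by []|by left; lra|].
  move=> t; rewrite in_itv/= /btw; apply/idP/idP => [|].
    by move=> /or4P[/andP[]|/and3P[]|/andP[]|/and3P[]] *; apply/andP; split; lra.
  by move=> tx; apply/or4P/Or41.
exists x, 1, 1; split; [by left|by rewrite expr1n|by lra|by left; lra|].
move=> t; rewrite in_itv/= /btw; apply/idP/idP => [|].
  by move=> /or4P[/andP[]|/and3P[]|/andP[]|/and3P[]] *; apply/andP; split; lra.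
by move=> /andP[? ?]; apply/or4P/Or42; apply/and3P; split; lra.
Qed.

Lemma ray_itv u a b x : (forall t, btw x t = (t \in `[a, b])) ->
  mu.-integrable `[a, b] (EFin \o (fun t => u t / (2 * `|t|))) ->
  ray u x = (\int[mu]_(t in `[a, b]) (u t / (2 * `|t|)))%:E.
Proof.
move=> xab iu; rewrite /Rintegral fineK; last exact: integrable_fin_num.
rewrite [RHS]integral_mkcond; apply: eq_integral => t _.
by rewrite patchE mem_setE -xab; case: btw; rewrite ?mul1r ?mul0r.
Qed.

Section pointwise.
Variables (h g : R -> R).
Hypotheses (hg : antiderivative h g) (h1 : h 1 = 0) (hN1 : h (- 1) = 0)
  (ig2 : N.-integrable setT (EFin \o (fun t => g t ^+ 2))).

Let h_unit e : e ^+ 2 = 1 -> h e = 0.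
Proof. by move=> /eqP; rewrite sqrf_eq1 => /orP[] /eqP ->. Qed.

Lemma sqr_le_ray x : x != 0 ->
  ((h x ^+ 2)%:E <= `|x ^+ 2 - 1|%:E * ray (fun t => (g t ^+ 2)%R) x)%E.
Proof.
move=> /btw_itv[a [b [e [xe e1 ab ab0 xab]]]]; have [[mg _ _] _] := hg.
have ig2ab := integrable_normal_itv a b ig2.
have mg2 : measurable_fun setT (fun t => g t ^+ 2) by exact: measurable_funX.
rewrite (ray_itv xab (integrable_weight ab0 mg2 ig2ab)) -EFinM lee_fin.
have := cauchy_schwarz_itv hg ab ab0 ig2ab.
case: xe => -[-> ->]; rewrite (h_unit e1) e1 ?subr0//.
by rewrite sub0r sqrrN distrC.
Qed.

Lemma eq_ray_proportional x y : x != 0 ->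
  ((h x ^+ 2)%:E = `|x ^+ 2 - 1|%:E * ray (fun t => (g t ^+ 2)%R) x)%E ->
  btw x y -> h y * (x ^+ 2 - 1) = h x * (y ^+ 2 - 1).
Proof.
move=> /btw_itv[a [b [e [xe e1 ab ab0 xab]]]]; have [[mg _ _] _] := hg.
have ig2ab := integrable_normal_itv a b ig2.
have mg2 : measurable_fun setT (fun t => g t ^+ 2) by exact: measurable_funX.
rewrite (ray_itv xab (integrable_weight ab0 mg2 ig2ab)) -EFinM => -[Ex].
rewrite xab in_itv/= => /andP[ay yb].
have H := cauchy_schwarz_itv_eq hg ay yb ab0 ig2ab.
case: xe ay yb ab0 Ex H => -[-> ->] ay yb ab0 Ex; rewrite (h_unit e1) e1 ?subr0.
  rewrite sub0r sqrrN (distrC 1) => /(_ Ex) H.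
  (* Here [x] is the left end point, so [H] compares increments from [x] and not from the zero [e]
     of [h]; the identity converts one into the other. *)
  have : h y * (x ^+ 2 - 1) = h x * (y ^+ 2 - 1) + (- ((h y - h x) * (1 - x ^+ 2)) +
    (- h x * (y ^+ 2 - x ^+ 2))) by ring.
  by move=> ->; rewrite H addNr addr0.
by move=> /(_ Ex).
Qed.

Let mh2 : measurable_fun setT (fun x => h x ^+ 2).
Proof.
apply: measurable_funX; apply: continuous_measurable_fun.
exact: antiderivative_continuous hg.
Qed.

Let x_neq0 : {ae N, forall x, x != 0}.
Proof.
apply/ae_normal_lebesgue; exists [set 0]; split;
  [exact: measurable_set1|exact: lebesgue_measure_set1|].
by move=> t /=; apply: contra_notP => /eqP.
Qed.

Let g20 t : 0 <= g t ^+ 2. Proof. exact: sqr_ge0. Qed.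

Let mg2 : measurable_fun setT (fun t => g t ^+ 2).
Proof. by have [[mg _ _] _] := hg; exact: measurable_funX. Qed.

Let ray_ge0 x : (0 <= `|x ^+ 2 - 1|%:E * ray (fun t => (g t ^+ 2)%R) x)%E.
Proof.
rewrite mule_ge0// /ray; apply: integral_ge0 => t _.
by rewrite lee_fin mulr_ge0// divr_ge0// mulr_ge0.
Qed.

Lemma integral_sqr_le : (\int[N]_x (h x ^+ 2)%:E <= \int[N]_t (g t ^+ 2 / 2)%:E)%E.
Proof.
have [mray <-] := ray_tonelli mg2 g20.
apply: ae_ge0_le_integral => //.
- by move=> x _; rewrite lee_fin sqr_ge0.
- exact/measurable_EFinP.
- by apply: ae_imp x_neq0 => x x0 _; exact: sqr_le_ray.
Qed.

Lemma integrable_sqr : N.-integrable setT (EFin \o (fun x => h x ^+ 2)).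
Proof.
apply/integrableP; split; first exact/measurable_EFinP.
under eq_integral do rewrite gee0_abs ?lee_fin ?sqr_ge0//.
apply: le_lt_trans integral_sqr_le _.
have ig : N.-integrable setT (EFin \o (fun t => 2^-1 * g t ^+ 2)) by exact: integrableMlr.
have /integrableP[_] := ig; apply: le_lt_trans; rewrite le_eqVlt; apply/orP; left; apply/eqP.
apply: eq_integral => t _; rewrite gee0_abs /=; first by rewrite mulrC.
by rewrite lee_fin mulr_ge0 ?invr_ge0// sqr_ge0.
Qed.

(** The difference of the two sides is nonnegative with integral 0, hence vanishes almost
    everywhere. Subtracting the integrals is legitimate because [integrable_sqr] makes both
    finite. *)
Lemma integral_sqr_eq :
  (\int[N]_x (h x ^+ 2)%:E = \int[N]_t (g t ^+ 2 / 2)%:E)%E ->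
  {ae mu, forall x,
    ((h x ^+ 2)%:E = `|x ^+ 2 - 1|%:E * ray (fun t => (g t ^+ 2)%R) x)%E}.
Proof.
move=> heq; have [mray Eray] := ray_tonelli mg2 g20.
set A := fun x => (`|x ^+ 2 - 1|%:E * ray (fun t => (g t ^+ 2)%R) x)%E in mray Eray *.
have ih2 := integrable_sqr.
have A0 x : (0 <= A x)%E by exact: ray_ge0.
have iA : N.-integrable setT A.
  apply/integrableP; split => //.
  under eq_integral do rewrite gee0_abs ?A0//.
  rewrite Eray -heq; have /integrableP[_] := ih2; apply: le_lt_trans.
  by under [leRHS]eq_integral do rewrite gee0_abs ?lee_fin ?sqr_ge0//.
have mD : measurable_fun setT (A \- (EFin \o (fun x => (h x ^+ 2)%R)))%E.
  by apply: emeasurable_funB => //; exact/measurable_EFinP.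
have : (\int[N]_x `|(A \- (EFin \o (fun x => (h x ^+ 2)%R))) x| = 0)%E.
  transitivity (\int[N]_x (A \- (EFin \o (fun x => (h x ^+ 2)%R))) x)%E.
    apply: ae_eq_integral => //; first exact: measurableT_comp.
    apply: ae_imp x_neq0 => x x0 _; rewrite gee0_abs// sube_ge0 ?fin_numE//.
    exact: sqr_le_ray.
  rewrite integralB// Eray -heq subee//.
  exact: integrable_fin_num.
move=> /ae_eq_integral_abs => /(_ measurableT mD) H.
apply/ae_normal_lebesgue; apply: ae_imp H => x /(_ I); rewrite /= -/(A x).
by case: (A x) => //= r -[/eqP]; rewrite subr_eq0 => /eqP ->.
Qed.

(** The point [x] of equality may depend on [y]. Comparing both [y] and the fixed [y0] with the same
    [x] eliminates it, and the factor is read off at [y0]. *)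
Lemma proportional_on (S : set R) y0 : y0 ^+ 2 != 1 ->
  (forall y, S y -> exists x, [/\ x != 0, x ^+ 2 != 1, 
     ((h x ^+ 2)%:E = `|x ^+ 2 - 1|%:E * ray (fun t => (g t ^+ 2)%R) x)%E,
     btw x y & btw x y0]) ->
  exists l, forall y, S y -> h y = l * (y ^+ 2 - 1).
Proof.
move=> y01 HS; exists (h y0 / (y0 ^+ 2 - 1)) => y /HS[x [x0 x1 Ex xy xy0]].
have H := eq_ray_proportional x0 Ex xy; have H0 := eq_ray_proportional x0 Ex xy0.
rewrite -subr_eq0 in x1; rewrite -subr_eq0 in y01.
apply: (mulIf x1); rewrite H.
have -> : h x = h y0 * (x ^+ 2 - 1) / (y0 ^+ 2 - 1) by rewrite H0 mulfK.
by ring.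
Qed.

Hypothesis heq : (\int[N]_x (h x ^+ 2)%:E = \int[N]_t (g t ^+ 2 / 2)%:E)%E.

Let Ex_itv a b : a < b -> exists2 x, x \in `]a, b[ &
   ((h x ^+ 2)%:E = `|x ^+ 2 - 1|%:E * ray (fun t => (g t ^+ 2)%R) x)%E.
Proof. by move=> ab; exact: ae_exists_itv ab (integral_sqr_eq heq). Qed.

Let sqr_neq1 x : x != 1 -> x != -1 -> x ^+ 2 != 1.
Proof. by move=> x1 x2; rewrite sqrf_eq1 negb_or x1. Qed.

Lemma region_right : exists l, forall y, 1 <= y -> h y = l * (y ^+ 2 - 1).
Proof.
apply: (@proportional_on [set y | 1 <= y] 2); first by apply: sqr_neq1; apply/eqP; lra.
(* Equality is known only for almost every [x], so [x] is found in an interval beyond both [y] and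
   the reference point 2; both then lie between 1 and [x]. *)
move=> y /= y1; have [x] := @Ex_itv (y + 2) (y + 3) ltac:(lra).
rewrite in_itv/= => /andP[x1 x2] Ex; exists x; split => //.
- by apply/eqP; lra.
- by apply: sqr_neq1; apply/eqP; lra.
- by apply/or4P/Or41/andP; split; lra.
- by apply/or4P/Or41/andP; split; lra.
Qed.

Lemma region_midright : exists l, forall y, 0 < y <= 1 -> h y = l * (y ^+ 2 - 1).
Proof.
apply: (@proportional_on [set y | 0 < y <= 1] 2^-1); first by apply: sqr_neq1; apply/eqP; lra.
(* As y <= 1, such an [x] is closer to 0 than both [y] and the reference point 1/2, which therefore
   lie between [x] and 1. *)
move=> y /= /andP[y0 y1]; have [x] := @Ex_itv 0 (y / 2) ltac:(lra).
rewrite in_itv/= => /andP[x1 x2] Ex; exists x; split => //.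
- by apply/eqP; lra.
- by apply: sqr_neq1; apply/eqP; lra.
- by apply/or4P/Or42/and3P; split; lra.
- by apply/or4P/Or42/and3P; split; lra.
Qed.

Lemma region_midleft : exists l, forall y, -1 <= y < 0 -> h y = l * (y ^+ 2 - 1).
Proof.
apply: (@proportional_on [set y | -1 <= y < 0] (- 2^-1)); first by apply: sqr_neq1; apply/eqP; lra.
move=> y /= /andP[y0 y1]; have [x] := @Ex_itv (y / 2) 0 ltac:(lra).
rewrite in_itv/= => /andP[x1 x2] Ex; exists x; split => //.
- by apply/eqP; lra.
- by apply: sqr_neq1; apply/eqP; lra.
- by apply/or4P/Or44/and3P; split; lra.
- by apply/or4P/Or44/and3P; split; lra.
Qed.

Lemma region_left : exists l, forall y, y <= -1 -> h y = l * (y ^+ 2 - 1).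
Proof.
apply: (@proportional_on [set y | y <= -1] (- 2)); first by apply: sqr_neq1; apply/eqP; lra.
move=> y /= y1; have [x] := @Ex_itv (y - 3) (y - 2) ltac:(lra).
rewrite in_itv/= => /andP[x1 x2] Ex; exists x; split => //.
- by apply/eqP; lra.
- by apply: sqr_neq1; apply/eqP; lra.
- by apply/or4P/Or43/andP; split; lra.
- by apply/or4P/Or43/andP; split; lra.
Qed.

End pointwise.

End sharp_inequality.

(** * Gluing the four regions, and the energy bound for prescribed moments *)

Section second_order_poincare.
Context {R : realType}.
Local Notation mu := (@lebesgue_measure R).
Local Notation N := (@normal_prob R 0 1).
Implicit Types (a b x y t l : R) (f g h k u v F : R -> R).

Lemma continuous_eq0_itv k a b : a < b -> continuous k ->
  (forall y, a < y < b -> k y = 0) -> k a = 0 /\ k b = 0.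
Proof.
move=> ab ck k0.
have H c : k c != 0 -> exists2 e, 0 < e & forall y, `|c - y| < e -> k y != 0.
  by move=> kc; have := cvgr_neq0 _ (ck c) kc => -[e /= e0 He]; exists e.
split; apply/eqP/negPn/negP => /H[e e0 He].
  pose y := a + Num.min (e / 2) ((b - a) / 2).
  have ym : 0 < Num.min (e / 2) ((b - a) / 2) by rewrite lt_min; apply/andP; split; lra.
  have ye : Num.min (e / 2) ((b - a) / 2) <= e / 2 by rewrite ge_min lexx.
  have yb : Num.min (e / 2) ((b - a) / 2) <= (b - a) / 2 by rewrite ge_min lexx orbT.
  have ye' : `|a - y| < e by rewrite /y opprD addrA subrr sub0r normrN gtr0_norm//; lra.
  by have := He y ye'; rewrite k0 ?eqxx// /y; apply/andP; split; lra.
pose y := b - Num.min (e / 2) ((b - a) / 2).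
have ym : 0 < Num.min (e / 2) ((b - a) / 2) by rewrite lt_min; apply/andP; split; lra.
have ye : Num.min (e / 2) ((b - a) / 2) <= e / 2 by rewrite ge_min lexx.
have yb : Num.min (e / 2) ((b - a) / 2) <= (b - a) / 2 by rewrite ge_min lexx orbT.
have ye' : `|b - y| < e by rewrite /y opprB addrCA subrr addr0 gtr0_norm//; lra.
by have := He y ye'; rewrite k0 ?eqxx// /y; apply/andP; split; lra.
Qed.

Lemma is_derive_quadratic (a b c x : R) :
  is_derive x 1 (fun x => a * x ^+ 2 + b * x + c) (2 * a * x + b).
Proof.
have dM (c' : R) (p : R -> R) dp : is_derive x 1 p dp -> is_derive x 1 (fun x => c' * p x) (c' * dp).
  move=> H; apply: (is_derive_eq (is_deriveM (is_derive_cst c' x 1) H)).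
  by rewrite scaler0 addr0.
have dx2 : is_derive x 1 (fun x : R => x * x) (x + x).
  apply: (is_derive_eq (is_deriveM (is_derive_id x 1) (is_derive_id x 1))).
  by rewrite /GRing.scale/= mulr1.
have -> : (fun x => a * x ^+ 2 + b * x + c) =
    (fun x => a * (x * x)) + (fun x => b * x) + cst c.
  by apply/funext => y; rewrite !fctE expr2.
apply: (is_derive_eq (is_deriveD (is_deriveD (dM a _ _ dx2) (dM b _ _ (is_derive_id x 1)))
  (is_derive_cst c x 1))).
by ring.
Qed.

(** The formula for [h] can be differentiated only inside the interval; continuity of [g] carries
    the result to the end points, where neighbouring regions meet. *)
Lemma derive_region h g a b l : a < b -> (forall x : R, is_derive x 1 h (g x)) ->
  continuous g -> (forall y, a < y < b -> h y = l * (y ^+ 2 - 1)) ->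
  g a = 2 * l * a /\ g b = 2 * l * b.
Proof.
move=> ab dh cg hl.
have ck : continuous (fun y => g y - 2 * l * y).
  by move=> y; apply: cvgB; [exact: cg|apply: cvgMr; exact: cvg_id].
suff k0 y : a < y < b -> g y - 2 * l * y = 0.
  have [/eqP + /eqP] := continuous_eq0_itv ab ck k0.
  by rewrite !subr_eq0 => /eqP -> /eqP ->.
move=> /andP[ay yb]; apply/eqP; rewrite subr_eq0; apply/eqP.
have dq := is_derive_quadratic l 0 (- l) y.
rewrite addr0 in dq.
have dh' : is_derive y 1 h (2 * l * y).
  apply: near_eq_is_derive dq; near=> z.
  rewrite hl; first by ring.
  by apply/andP; split; near: z; [exact: lt_nbhsr|exact: lt_nbhsl].
rewrite -(@derive_val _ _ _ _ _ _ _ (dh y)).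
exact: (@derive_val _ _ _ _ _ _ _ dh').
Unshelve. all: by end_near. Qed.

Lemma antiderivative_is_derive h g : antiderivative h g -> continuous g ->
  forall x : R, is_derive x 1 h (g x).
Proof.
move=> hg cg x; apply: (antiderivative_lebesgue_pt hg).
apply: (@continuous_lebesgue_pt _ g x setT) => //.
- by split; [exact: openT|].
- exact: continuous_measurable_fun.
- exact: cg.
Qed.

(* On each of the four intervals cut out by -1, 0, 1 the function h is a multiple of x^2 - 1;
   continuity of h at 0 and of its derivative at -1 and 1 identifies the four factors. *)
Lemma equality_case h g : antiderivative h g -> continuous g ->
  h 1 = 0 -> h (- 1) = 0 -> N.-integrable setT (EFin \o (fun t => g t ^+ 2)) ->
  (\int[N]_x (h x ^+ 2)%:E = \int[N]_t (g t ^+ 2 / 2)%:E)%E ->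
  exists l, forall x, h x = l * (x ^+ 2 - 1).
Proof.
move=> hg cg h1 hN1 ig2 heq.
have dh := antiderivative_is_derive hg cg.
have ch := antiderivative_continuous hg.
have [l1 H1] := region_right hg h1 hN1 ig2 heq.
have [l2 H2] := region_midright hg h1 hN1 ig2 heq.
have [l3 H3] := region_midleft hg h1 hN1 ig2 heq.
have [l4 H4] := region_left hg h1 hN1 ig2 heq.
have [] := @derive_region h g 1 2 l1 ltac:(lra) dh cg.
  by move=> y /andP[? ?]; apply: H1; lra.
move=> g1 _.
have [] := @derive_region h g 0 1 l2 ltac:(lra) dh cg.
  by move=> y /andP[? ?]; apply: H2; apply/andP; split; lra.
move=> _ g1'.
have [] := @derive_region h g (-1) 0 l3 ltac:(lra) dh cg.
  by move=> y /andP[? ?]; apply: H3; apply/andP; split; lra.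
move=> gN1 _.
have [] := @derive_region h g (-2) (-1) l4 ltac:(lra) dh cg.
  by move=> y /andP[? ?]; apply: H4; lra.
move=> _ gN1'.
have ck l : continuous (fun y => h y - l * (y ^+ 2 - 1)).
  move=> y; apply: cvgB; first exact: ch.
  by apply: cvgMr; apply: cvgB; [exact: exprn_continuous|exact: cvg_cst].
(* At 0 the slope 2 l x vanishes for every factor and distinguishes nothing, so the two middle
   factors are compared through the value h(0) = -l. *)
have [] := @continuous_eq0_itv _ 0 1 ltac:(lra) (ck l2).
  by move=> y /andP[? ?]; rewrite H2 ?subrr//; apply/andP; split; lra.
rewrite expr0n/= sub0r => h02 _.
have [] := @continuous_eq0_itv _ (-1) 0 ltac:(lra) (ck l3).
  by move=> y /andP[? ?]; rewrite H3 ?subrr//; apply/andP; split; lra.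
rewrite expr0n/= sub0r => _ h03.
have l12 : l1 = l2 by lra.
have l23 : l2 = l3 by lra.
have l34 : l3 = l4 by lra.
exists l2 => x.
have [x1|x1] := leP 1 x; first by rewrite H1// l12.
have [x0|x0|<-] := ltgtP 0 x; first by apply: H2; apply/andP; split; lra.
  have [xN1|xN1] := leP x (-1); first by rewrite H4// l23 l34.
  by rewrite H3 ?l23//; apply/andP; split; lra.
by rewrite expr0n/= sub0r; lra.
Qed.

Lemma integrable_normal_mul u v : measurable_fun setT u -> measurable_fun setT v ->
  N.-integrable setT (EFin \o (fun x => u x ^+ 2)) ->
  N.-integrable setT (EFin \o (fun x => v x ^+ 2)) ->
  N.-integrable setT (EFin \o (fun x => u x * v x)).
Proof.
move=> mum mv iu iv.
apply: le_integrable (integrableDr measurableT iu iv) => //.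
  by apply/measurable_EFinP; exact: measurable_funM.
move=> x _ /=; rewrite lee_fin normrM (@ger0_norm _ (_ + _)) ?addr_ge0 ?sqr_ge0//.
rewrite -(real_normK (num_real (u x))) -(real_normK (num_real (v x))).
have := sqr_ge0 (`|u x| - `|v x|); have := sqr_ge0 (`|u x|); have := sqr_ge0 (`|v x|).
have := mulr_ge0 (normr_ge0 (u x)) (normr_ge0 (v x)).
rewrite sqrrB; set p := `|u x| * _; lra.
Qed.

Lemma integrable_normal_L2_L1 u : measurable_fun setT u ->
  N.-integrable setT (EFin \o (fun x => u x ^+ 2)) -> N.-integrable setT (EFin \o u).
Proof.
move=> mum iu2.
have i1 : N.-integrable setT (EFin \o (fun x : R => 1 ^+ 2 : R)).
  apply: (@integrable_normal_quartic _ _ 1) => // x.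
  by rewrite expr1n normr1 mul1r lerDl exprn_even_ge0.
have := integrable_normal_mul (measurable_cst (1 : R)) mum i1 iu2.
by apply: eq_integrable => // x _; rewrite /= mul1r.
Qed.

Lemma integrable_normal_idM u : measurable_fun setT u ->
  N.-integrable setT (EFin \o (fun x => u x ^+ 2)) ->
  N.-integrable setT (EFin \o (fun x => x * u x)).
Proof. by move=> mum; apply: integrable_normal_mul => //; exact: integrable_normal_expr. Qed.

Lemma EFin_Rintegral_normal u : N.-integrable setT (EFin \o u) ->
  (\int[N]_x (u x)%:E = (\int[N]_x u x)%:E)%E.
Proof. by move=> iu; rewrite /Rintegral fineK//; exact: integrable_fin_num. Qed.

Lemma antiderivative_affine F g s c : antiderivative F g ->
  antiderivative (fun x => F x - (s * x + c)) (fun x => g x - s).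
Proof.
move=> [lg Fg].
have ls : locally_integrable setT (fun=> s : R).
  by apply: continuous_locally_integrable => x; exact: cst_continuous.
split; first exact: locally_integrableB.
move=> a b ab; rewrite RintegralB//; [|exact: locally_integrable_itv..].
rewrite -Fg//.
have -> : \int[mu]_(x in `[a, b]) s = s * b - s * a.
  apply: (FTC2_Rintegral (F := fun x => s * x)) => //.
    move=> x; apply: (is_derive_eq (is_deriveM (is_derive_cst s x 1) (is_derive_id x 1))).
    by rewrite scaler0 addr0 /GRing.scale/= mulr1.
  by move=> x; exact: cst_continuous.
by ring.
Qed.

(** Applied twice: to the weak derivative itself for the bound, and to its continuous representative
    for the equality case. Hence the mean of [g] is a hypothesis, and continuity is a premise of the
    second part. *)
Lemma poincare2 F g (m0 m1 m2 : R) : antiderivative F g ->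
  N.-integrable setT (EFin \o (fun x => F x ^+ 2)) ->
  N.-integrable setT (EFin \o (fun x => g x ^+ 2)) ->
  \int[N]_x F x = m0 -> \int[N]_x (x * F x) = m1 -> \int[N]_x (F x ^+ 2) = m2 ->
  \int[N]_x g x = m1 ->
  2 * (m2 - m0 ^+ 2 - m1 ^+ 2) + m1 ^+ 2 <= \int[N]_x (g x ^+ 2) /\
  (continuous g -> \int[N]_x (g x ^+ 2) = 2 * (m2 - m0 ^+ 2 - m1 ^+ 2) + m1 ^+ 2 ->
   exists a, forall x, F x = a * x ^+ 2 + m1 * x + (m0 - a)).
Proof.
move=> Fg iF2 ig2 E0 E1 E2 Eg.
have cF := antiderivative_continuous Fg.
have mF : measurable_fun setT F by exact: continuous_measurable_fun.
have [[mg _ _] _] := Fg.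
pose s := (F 1 - F (-1)) / 2; pose c := (F 1 + F (-1)) / 2.
pose h x := F x - (s * x + c).
have hg : antiderivative h (fun x => g x - s) by exact: antiderivative_affine.
have h1 : h 1 = 0 by rewrite /h /s /c; field.
have hN1 : h (-1) = 0 by rewrite /h /s /c; field.
have iF := integrable_normal_L2_L1 mF iF2.
have ig := integrable_normal_L2_L1 mg ig2.
have ixF := integrable_normal_idM mF iF2.
pose Q (c0 c1 c2 c3 c4 : R) x :=
  c0 * x ^+ 0 + (c1 * x ^+ 1 + (c2 * x ^+ 2 + (c3 * x ^+ 3 + c4 * x ^+ 4))).
have iQ c0 c1 c2 c3 c4 : N.-integrable setT (EFin \o (Q c0 c1 c2 c3 c4)).
  exact: integrable_normal_quartic_sum.
have iX : N.-integrable setT (EFin \o (fun x => (-2 * s) * g x + Q (s ^+ 2) 0 0 0 0 x)).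
  by apply: integrableDr => //; exact: integrableMlr.
have gsE : (fun x => (g x - s) ^+ 2) =
    fun x => g x ^+ 2 + ((-2 * s) * g x + Q (s ^+ 2) 0 0 0 0 x).
  by apply/funext => x; rewrite /Q; ring.
have igs2 : N.-integrable setT (EFin \o (fun x => (g x - s) ^+ 2)).
  by rewrite gsE; exact: integrableDr.
have Egs : \int[N]_x ((g x - s) ^+ 2) = \int[N]_x (g x ^+ 2) - 2 * s * m1 + s ^+ 2.
  rewrite gsE RintegralD// RintegralD//; last exact: integrableMlr.
  by rewrite RintegralZl// Eg Rintegral_normal_quartic; ring.
have i4 : N.-integrable setT (EFin \o (fun x => (-2 * c) * F x + Q (c ^+ 2) (2 * s * c) (s ^+ 2) 0 0 x)).
  by apply: integrableDr => //; exact: integrableMlr.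
have i5 : N.-integrable setT (EFin \o (fun x => (-2 * s) * (x * F x) +
    ((-2 * c) * F x + Q (c ^+ 2) (2 * s * c) (s ^+ 2) 0 0 x))).
  by apply: integrableDr => //; exact: integrableMlr.
have hE : (fun x => h x ^+ 2) = fun x => F x ^+ 2 + ((-2 * s) * (x * F x) +
    ((-2 * c) * F x + Q (c ^+ 2) (2 * s * c) (s ^+ 2) 0 0 x)).
  by apply/funext => x; rewrite /h /Q; ring.
have Eh : \int[N]_x (h x ^+ 2) = m2 - 2 * s * m1 - 2 * c * m0 + s ^+ 2 + c ^+ 2.
  rewrite hE RintegralD// RintegralD//; last exact: integrableMlr.
  rewrite RintegralD//; last exact: integrableMlr.
  by rewrite RintegralZl// RintegralZl// E0 E1 E2 Rintegral_normal_quartic; ring.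
have ih2 : N.-integrable setT (EFin \o (fun x => h x ^+ 2)) by exact: (integrable_sqr hg).
have igs2' : N.-integrable setT (EFin \o (fun x => (g x - s) ^+ 2 / 2)).
  rewrite (_ : (fun x => (g x - s) ^+ 2 / 2) = fun x => 2^-1 * (g x - s) ^+ 2).
    exact: integrableMlr.
  by apply/funext => x; rewrite mulrC.
have Egs2 : \int[N]_x ((g x - s) ^+ 2 / 2) =
    (\int[N]_x (g x ^+ 2) - 2 * s * m1 + s ^+ 2) / 2.
  rewrite (_ : (fun x => (g x - s) ^+ 2 / 2) = fun x => 2^-1 * (g x - s) ^+ 2); last first.
    by apply/funext => x; rewrite mulrC.
  by rewrite RintegralZl// Egs mulrC.
have := integral_sqr_le hg h1 hN1 igs2.
rewrite !EFin_Rintegral_normal// lee_fin Eh Egs2 => hle.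
have H1 := sqr_ge0 (s - m1); have H2 := sqr_ge0 (c - m0).
have H1E : (s - m1) ^+ 2 = s ^+ 2 - 2 * s * m1 + m1 ^+ 2 by ring.
have H2E : (c - m0) ^+ 2 = c ^+ 2 - 2 * c * m0 + m0 ^+ 2 by ring.
split; first by lra.
move=> cg Eg2.
have sm1 : s = m1.
  by apply/eqP; rewrite -subr_eq0 -sqrf_eq0; apply/eqP; lra.
have cm0 : c = m0.
  by apply/eqP; rewrite -subr_eq0 -sqrf_eq0; apply/eqP; lra.
have heq : (\int[N]_x (h x ^+ 2)%:E = \int[N]_x ((g x - s) ^+ 2 / 2)%:E)%E.
  by rewrite !EFin_Rintegral_normal// Eh Egs2; congr EFin; lra.
have cgs : continuous (fun x => g x - s).
  by move=> x; apply: cvgB; [exact: cg|exact: cvg_cst].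
have [a Ha] := equality_case hg cgs h1 hN1 igs2 heq.
exists a => x; have := Ha x; rewrite /h sm1 cm0 => /eqP.
by rewrite subr_eq => /eqP ->; ring.
Qed.

End second_order_poincare.

(** * Moment constraints and minimizers *)

Section normal_expectation.
Context {R : realType} {d : measure_display} {T : measurableType d}
  {P : probability T R} {Z : {RV P >-> R}}.
Hypothesis hZ : standard_normal Z.
Local Notation mu := (@lebesgue_measure R).
Local Notation N := (@normal_prob R 0 1).
Implicit Types (u f g F sigma : R -> R).

(* [normal_prob] lives on [measurableTypeR R], whose display differs from the one of
   the codomain of [Z]. *)
Let mZ : measurable_fun setT (Z : T -> measurableTypeR R).
Proof.
have mZ0 : measurable_fun setT (Z : T -> R) by [].
by move=> mD B mB; exact: (mZ0 mD B mB).
Qed.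

Let integral_pushforwardZ (u : R -> \bar R) :
  (\int[pushforward P (Z : T -> measurableTypeR R)]_x u x = \int[N]_x u x)%E.
Proof. by apply: eq_measure_integral => A mA _; exact: (hZ mA). Qed.

Lemma integrable_standard_normal u : measurable_fun setT u ->
  P.-integrable setT (fun t => (u (Z t))%:E) <-> N.-integrable setT (EFin \o u).
Proof.
move=> mum.
have E : (\int[P]_t `|(u (Z t))%:E| = \int[N]_x `|(u x)%:E|)%E.
  rewrite -integral_pushforwardZ (ge0_integral_pushforward mZ)//.
  by apply: measurableT_comp => //; exact/measurable_EFinP.
split=> /integrableP[_ iu]; apply/integrableP; split.
- exact/measurable_EFinP.
- by rewrite -E.
- by apply/measurable_EFinP; exact: measurableT_comp.
- by rewrite E.
Qed.

Lemma expectation_standard_normal u : N.-integrable setT (EFin \o u) ->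
  ('E_P[fun t => u (Z t)] = (\int[N]_x u x)%:E)%E.
Proof.
move=> iu; have mum : measurable_fun setT u by apply/measurable_EFinP; exact: measurable_int iu.
rewrite unlock -EFin_Rintegral_normal// -integral_pushforwardZ (integral_pushforward mZ)//.
  exact/measurable_EFinP.
by rewrite preimage_setT; exact/integrable_standard_normal.
Qed.

Lemma weak_deriveP f : weakly_derivable f -> is_weak_derive f (weak_derive f).
Proof. by move=> [g fg]; rewrite /weak_derive; case: xgetP => [h -> //|/(_ g)]. Qed.

Lemma Rintegral_normal_ae f g : measurable_fun setT f -> measurable_fun setT g ->
  {ae mu, forall x, f x = g x} -> \int[N]_x f x = \int[N]_x g x.
Proof.
move=> mf mg /ae_normal_lebesgue fg; congr fine; apply: ae_eq_integral => //.
- exact/measurable_EFinP.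
- exact/measurable_EFinP.
- by apply: ae_imp fg => x -> _.
Qed.

Lemma integrable_normal_ae f g : measurable_fun setT g ->
  {ae mu, forall x, f x = g x} -> N.-integrable setT (EFin \o f) ->
  N.-integrable setT (EFin \o g).
Proof.
move=> mg /ae_normal_lebesgue fg iff.
have mf : measurable_fun setT f by apply/measurable_EFinP; exact: measurable_int iff.
have /integrableP[_ fy] := iff; apply/integrableP; split; first exact/measurable_EFinP.
rewrite (_ : (\int[N]_x _)%E = (\int[N]_x `|(EFin \o f) x|)%E)//.
apply: ae_eq_integral => //.
- by apply: measurableT_comp => //; exact/measurable_EFinP.
- by apply: measurableT_comp => //; exact/measurable_EFinP.
- by apply: ae_imp fg => x /= -> _.
Qed.

Lemma weak_derive_measurable f g : is_weak_derive f g ->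
  measurable_fun setT f /\ measurable_fun setT g.
Proof. by move=> [[mf _ _] [mg _ _] _]. Qed.

(** The constraints, transported to real integrals against the law of [Z]. The derivative is an
    argument of its own, free of the choice made in [weak_derive]. *)
Record moments (mu0 mu1 mu2 : R) f g : Prop := Moments {
  moments_weak_derive : is_weak_derive f g;
  moments_sqr : N.-integrable setT (EFin \o (fun x => f x ^+ 2));
  moments_derive_sqr : N.-integrable setT (EFin \o (fun x => g x ^+ 2));
  moments0 : \int[N]_x f x = mu0;
  moments1 : \int[N]_x (x * f x) = mu1;
  moments2 : \int[N]_x (f x ^+ 2) = mu2 }.

Lemma feasibleP mu0 mu1 mu2 sigma : feasible Z mu0 mu1 mu2 sigma <->
  moments mu0 mu1 mu2 sigma (weak_derive sigma) /\ weakly_derivable (weak_derive sigma).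
Proof.
split=> [[[[ws wg] is2 ig2]] E0 E1 E2|[[sg is2 ig2 E0 E1 E2] wg]].
  have sg := weak_deriveP ws; have [ms mg] := weak_derive_measurable sg.
  have {}is2 : N.-integrable setT (EFin \o (fun x => sigma x ^+ 2)).
    by apply/(integrable_standard_normal (u := fun x => sigma x ^+ 2)) => //; exact: measurable_funX.
  have {}ig2 : N.-integrable setT (EFin \o (fun x => weak_derive sigma x ^+ 2)).
    by apply/(integrable_standard_normal (u := fun x => weak_derive sigma x ^+ 2)) => //;
      exact: measurable_funX.
  split=> //; split => //.
  - by move: E0; rewrite (expectation_standard_normal (integrable_normal_L2_L1 ms is2)) => -[].
  - by move: E1; rewrite (expectation_standard_normal (integrable_normal_idM ms is2)) => -[].
  - by move: E2; rewrite (expectation_standard_normal is2) => -[].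
have [ms mg] := weak_derive_measurable sg.
split.
- split; first by split => //; exists (weak_derive sigma).
    by apply/(integrable_standard_normal (u := fun x => sigma x ^+ 2)) => //; exact: measurable_funX.
  by apply/(integrable_standard_normal (u := fun x => weak_derive sigma x ^+ 2)) => //;
      exact: measurable_funX.
- by rewrite (expectation_standard_normal (integrable_normal_L2_L1 ms is2)) E0.
- by rewrite (expectation_standard_normal (integrable_normal_idM ms is2)) E1.
- by rewrite (expectation_standard_normal is2) E2.
Qed.

Lemma sobolev_seminormE mu0 mu1 mu2 sigma :
  moments mu0 mu1 mu2 sigma (weak_derive sigma) ->
  sobolev_seminorm Z sigma = Num.sqrt (\int[N]_x (weak_derive sigma x ^+ 2)).
Proof.
move=> [_ _ ig2 _ _ _]; rewrite /sobolev_seminorm.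
by rewrite (expectation_standard_normal ig2).
Qed.

Lemma moments_lower_bound mu0 mu1 mu2 f g : moments mu0 mu1 mu2 f g ->
  2 * (mu2 - mu0 ^+ 2 - mu1 ^+ 2) + mu1 ^+ 2 <= \int[N]_x (g x ^+ 2) /\
  (weakly_derivable g -> \int[N]_x (g x ^+ 2) = 2 * (mu2 - mu0 ^+ 2 - mu1 ^+ 2) + mu1 ^+ 2 ->
   exists a, {ae mu, forall x, f x = a * x ^+ 2 + mu1 * x + (mu0 - a)}).
Proof.
move=> [fg if2 ig2 E0 E1 E2]; have [mf mg] := weak_derive_measurable fg.
have [F Fg fF] := weak_derive_antiderivative fg.
have mF : measurable_fun setT F.
  by apply: continuous_measurable_fun; exact: antiderivative_continuous Fg.
have mid : measurable_fun setT (fun x : R => x) by exact: measurable_id.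
have fF2 : {ae mu, forall x, f x ^+ 2 = F x ^+ 2} by apply: ae_imp fF => x ->.
have iF2 : N.-integrable setT (EFin \o (fun x => F x ^+ 2)).
  by apply: integrable_normal_ae fF2 if2; exact: measurable_funX.
have E0' : \int[N]_x F x = mu0 by rewrite -E0; apply/esym/Rintegral_normal_ae.
have E1' : \int[N]_x (x * F x) = mu1.
  rewrite -E1; apply/esym/Rintegral_normal_ae; [exact: measurable_funM..|].
  by apply: ae_imp fF => x ->.
have E2' : \int[N]_x (F x ^+ 2) = mu2.
  by rewrite -E2; apply/esym/Rintegral_normal_ae => //; exact: measurable_funX.
have Eg : \int[N]_x g x = mu1.
  rewrite (stein fg) ?E1//; [exact: integrable_normal_L2_L1|exact: integrable_normal_idM|exact: integrable_normal_L2_L1].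
split; first by have [] := poincare2 Fg iF2 ig2 E0' E1' E2' Eg.
(* The second weak derivative [k] gives [g] a continuous representative [G], and [F] is an
   antiderivative of [G] as well. *)
move=> [k gk] Eg2; have [G Gk gG] := weak_derive_antiderivative gk.
have cG := antiderivative_continuous Gk.
have mG : measurable_fun setT G by exact: continuous_measurable_fun.
have FG : antiderivative F G.
  have [_ Fab] := Fg; split; first exact: continuous_locally_integrable.
  move=> a b ab; rewrite (Fab _ _ ab); congr fine; apply: ae_eq_integral => //.
  - by apply/measurable_EFinP; exact: measurable_funTS.
  - by apply/measurable_EFinP; exact: measurable_funTS.
  - by apply: ae_imp gG => x -> _.
have gG2 : {ae mu, forall x, g x ^+ 2 = G x ^+ 2} by apply: ae_imp gG => x ->.
have iG2 : N.-integrable setT (EFin \o (fun x => G x ^+ 2)).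
  by apply: integrable_normal_ae gG2 ig2; exact: measurable_funX.
have EG : \int[N]_x G x = mu1 by rewrite -Eg; apply/esym/Rintegral_normal_ae.
have EG2 : \int[N]_x (G x ^+ 2) = 2 * (mu2 - mu0 ^+ 2 - mu1 ^+ 2) + mu1 ^+ 2.
  by rewrite -Eg2; apply/esym/Rintegral_normal_ae => //; exact: measurable_funX.
have [_ /(_ cG EG2)[a Fa]] := poincare2 FG iF2 iG2 E0' E1' E2' EG.
by exists a; apply: ae_imp fF => x ->; exact: Fa.
Qed.

(** The lower bound is attained: for q = a x^2 + mu1 x + (mu0 - a) one gets E(q^2) = 2 a^2 + mu0^2 +
    mu1^2 and E(q'^2) = 4 a^2 + mu1^2. *)
Lemma quadratic_moments (mu0 mu1 mu2 a : R) sigma :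
  measurable_fun setT sigma -> 2 * a ^+ 2 = mu2 - mu0 ^+ 2 - mu1 ^+ 2 ->
  {ae mu, forall x, sigma x = a * x ^+ 2 + mu1 * x + (mu0 - a)} ->
  [/\ moments mu0 mu1 mu2 sigma (weak_derive sigma),
      weakly_derivable (weak_derive sigma) &
      \int[N]_x (weak_derive sigma x ^+ 2) = 2 * (mu2 - mu0 ^+ 2 - mu1 ^+ 2) + mu1 ^+ 2].
Proof.
move=> ms a2 sq.
pose q x := a * x ^+ 2 + mu1 * x + (mu0 - a); pose dq x := 2 * a * x + mu1.
have dqP (x : R) : is_derive x 1 q (dq x) by exact: is_derive_quadratic.
have ddqP (x : R) : is_derive x 1 dq ((fun=> 2 * a) x) by exact: is_derive_affine.
have cdq := is_derive_continuous ddqP.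
have cq := is_derive_continuous dqP.
have mq : measurable_fun setT q by exact: continuous_measurable_fun.
have mdq : measurable_fun setT dq by exact: continuous_measurable_fun.
have qs : {ae mu, forall x, q x = sigma x} by apply: ae_imp sq => x ->.
have sdq : is_weak_derive sigma dq := is_weak_derive_ae (C1_weak_derive dqP cdq) ms qs.
have sg : is_weak_derive sigma (weak_derive sigma) by apply: weak_deriveP; exists dq.
have [_ mg] := weak_derive_measurable sg.
(* [weak_derive] picks an unspecified representative; uniqueness ties it to the explicit derivative
   [dq]. *)
have dqg := weak_derive_ae_unique sdq sg.
have dqg2 : {ae mu, forall x, dq x ^+ 2 = weak_derive sigma x ^+ 2} by apply: ae_imp dqg => x ->.
have qs2 : {ae mu, forall x, q x ^+ 2 = sigma x ^+ 2} by apply: ae_imp qs => x ->.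
have idq2 : N.-integrable setT (EFin \o (fun x => dq x ^+ 2)).
  have := integrable_normal_quartic_sum (mu1 ^+ 2) (4 * a * mu1) (4 * a ^+ 2) 0 0.
  by apply: eq_integrable => // x _; rewrite /= /dq; congr EFin; ring.
have iq2 : N.-integrable setT (EFin \o (fun x => q x ^+ 2)).
  have := integrable_normal_quartic_sum ((mu0 - a) ^+ 2) (2 * mu1 * (mu0 - a))
    (mu1 ^+ 2 + 2 * a * (mu0 - a)) (2 * a * mu1) (a ^+ 2).
  by apply: eq_integrable => // x _; rewrite /= /q; congr EFin; ring.
have mid : measurable_fun setT (fun x : R => x) by exact: measurable_id.
split.
- split => //.
  + by apply: integrable_normal_ae qs2 iq2; exact: measurable_funX.
  + by apply: integrable_normal_ae dqg2 idq2; exact: measurable_funX.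
  + rewrite (Rintegral_normal_ae ms mq sq).
    have -> : q = fun x => (mu0 - a) * x ^+ 0 + (mu1 * x ^+ 1 + (a * x ^+ 2 + (0 * x ^+ 3 + 0 * x ^+ 4))).
      by apply/funext => x; rewrite /q; ring.
    by rewrite Rintegral_normal_quartic; ring.
  + rewrite (@Rintegral_normal_ae _ (fun x => x * q x)); [|exact: measurable_funM..|].
      have -> : (fun x => x * q x) = fun x => 0 * x ^+ 0 + ((mu0 - a) * x ^+ 1 +
          (mu1 * x ^+ 2 + (a * x ^+ 3 + 0 * x ^+ 4))).
        by apply/funext => x; rewrite /q; ring.
      by rewrite Rintegral_normal_quartic; ring.
    by apply: ae_imp sq => x ->.
  + rewrite -(Rintegral_normal_ae _ _ qs2); [|exact: measurable_funX..].
    rewrite /q Rintegral_normal_quadratic_sqr.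
    transitivity (2 * a ^+ 2 + mu0 ^+ 2 + mu1 ^+ 2); first by ring.
    by rewrite a2; ring.
- exists (fun=> 2 * a); apply: (is_weak_derive_ae _ mg dqg).
  by apply: C1_weak_derive => // x; exact: cst_continuous.
- rewrite -(Rintegral_normal_ae _ _ dqg2); [|exact: measurable_funX..].
  have -> : (fun x => dq x ^+ 2) = fun x => (0 * x ^+ 2 + (2 * a) * x + mu1) ^+ 2.
    by apply/funext => x; rewrite /dq; ring.
  rewrite Rintegral_normal_quadratic_sqr -a2; ring.
Qed.

End normal_expectation.

Unset Implicit Arguments.

Theorem theorem7 (R : realType) (d : measure_display) (T : measurableType d)
    (P : probability T R) (Z : {RV P >-> R}) (hZ : standard_normal Z)
    (mu0 mu1 mu2 mustar : R)
    (hmu : 0 <= mu2 - mu0 ^+ 2 - mu1 ^+ 2)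
    (hmustar : mustar = Num.sqrt (mu2 - mu0 ^+ 2 - mu1 ^+ 2))
    (sigma : R -> R) (hsigma : measurable_fun setT sigma) :
  is_minimizer Z mu0 mu1 mu2 sigma <->
  exists a : R, (a = mustar / Num.sqrt 2 \/ a = - (mustar / Num.sqrt 2)) /\
    {ae normal_prob 0 1, forall x : R,
      sigma x = a * x ^+ 2 + mu1 * x + (mu0 - a)}.
Proof.
(* The two signs together amount to one equation for a^2, which is what the second moment
   determines. *)
have aP (a : R) : (a = mustar / Num.sqrt 2 \/ a = - (mustar / Num.sqrt 2)) <->
    2 * a ^+ 2 = mu2 - mu0 ^+ 2 - mu1 ^+ 2.
  have s2 : (mustar / Num.sqrt 2) ^+ 2 = (mu2 - mu0 ^+ 2 - mu1 ^+ 2) / 2.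
    by rewrite expr_div_n hmustar !sqr_sqrtr.
  split=> [[->|->]|a2]; rewrite ?sqrrN ?s2; [by field..|].
  have : a ^+ 2 = (mustar / Num.sqrt 2) ^+ 2 by rewrite s2; lra.
  by move=> /eqP; rewrite eqf_sqr => /orP[] /eqP ->; [left|right].
(* [Num.sqrt] is 0 on negative numbers, so comparing radicands through their roots calls for a
   nonnegative bound. *)
have bound_ge0 : 0 <= 2 * (mu2 - mu0 ^+ 2 - mu1 ^+ 2) + mu1 ^+ 2.
  by rewrite addr_ge0 ?sqr_ge0// mulr_ge0.
split=> [[/(feasibleP hZ)[ms ws] smin]|[a [/aP a2 sq]]].
(* A competitor attaining the bound: minimality against it forces the energy of [sigma] down to the
   bound. Either sign of [a] would do. *)
- pose a := mustar / Num.sqrt 2.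
  have a2 : 2 * a ^+ 2 = mu2 - mu0 ^+ 2 - mu1 ^+ 2 by apply/aP; left.
  pose q x := a * x ^+ 2 + mu1 * x + (mu0 - a).
  have mq : measurable_fun setT q.
    apply: continuous_measurable_fun.
    exact: is_derive_continuous (fun x => is_derive_quadratic a mu1 (mu0 - a) x).
  have qq : {ae lebesgue_measure, forall x, q x = a * x ^+ 2 + mu1 * x + (mu0 - a)}.
    by apply: aeW.
  have [mo wq Eq] := quadratic_moments mq a2 qq.
  have := smin q ((feasibleP hZ _ _ _ _).2 (conj mo wq)).
  rewrite (sobolev_seminormE hZ ms) (sobolev_seminormE hZ mo) Eq ler_sqrt// => le_s.
  have [ge_s /(_ ws) H] := moments_lower_bound ms.
  have Es : \int[normal_prob 0 1]_x (weak_derive sigma x ^+ 2) =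
      2 * (mu2 - mu0 ^+ 2 - mu1 ^+ 2) + mu1 ^+ 2.
    by apply/eqP; rewrite eq_le le_s ge_s.
  (* The equality case leaves the leading coefficient [b] free; computing the second moment of
     [sigma] then fixes b^2. *)
  have [b sb] := H Es; exists b; split; last exact/ae_normal_lebesgue.
  apply/aP; have [_ _ _ _ _ <-] := ms.
  rewrite (@Rintegral_normal_ae _ _ (fun x => (b * x ^+ 2 + mu1 * x + (mu0 - b)) ^+ 2)).
  + by rewrite Rintegral_normal_quadratic_sqr; ring.
  + exact: measurable_funX.
  + apply: measurable_funX; apply: continuous_measurable_fun.
    exact: is_derive_continuous (fun x => is_derive_quadratic b mu1 (mu0 - b) x).
  + by apply: ae_imp sb => x ->.
- move/ae_normal_lebesgue in sq.
  have [mo wg Eg] := quadratic_moments hsigma a2 sq.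
  split; first exact/(feasibleP hZ).
  move=> tau /(feasibleP hZ)[mt wt].
  rewrite (sobolev_seminormE hZ mo) (sobolev_seminormE hZ mt) Eg ler_wsqrtr//.
  by have [] := moments_lower_bound mt.
Qed.
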